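(* Let $L$ be a Banach function space over $(X,\mu)$ and let $A_1,\ldots,A_m$ be positive kernel operators on $L$. Then $$\rho\left(A_1^{\left(\frac1m\right)}\circ A_2^{\left(\frac1m\right)}\circ\cdots\circ A_m^{\left(\frac1m\right)}\right)\le \rho(A_1A_2\cdots A_m)^{\frac1m}.$$ If, in addition, $L\in\mathcal{L}$ (and so $A_1,\ldots,A_m$ can be considered as non-negative matrices that define operators on $L$), then $$\rho(A_1\circ A_2\circ\cdots\circ A_m)\le\rho(A_1A_2\cdots A_m).$$
   Context: Let $\mu$ be a $\sigma$-finite positive measure on a $\sigma$-algebra of subsets of a non-void set $X$, and let $M(X,\mu)$ be the vector space of all equivalence classes of (almost everywhere equal) complex measurable functions on $X$. A Banach space $L\subseteq M(X,\mu)$ is a Banach function space if $f\in L$, $g\in M(X,\mu)$ and $|g|\le|f|$ imply $g\in L$ and $\|g\|\le\|f\|$. It is assumed that $X$ is the carrier of $L$: there is no subset $Y$ of $X$ of strictly positive measure such that $f=0$ a.e. on $Y$ for all $f\in L$. An operator on $L$ means a linear operator $L\to L$; it is positive if it maps non-negative functions to non-negative functions (positive operators on $L$ are automatically bounded). An operator $K$ on $L$ is a kernel operator if there is a $\mu\times\mu$-measurable function $k(x,y)$ on $X\times X$ such that for all $f\in L$ and almost all $x\in X$, $\int_X|k(x,y)f(y)|\,d\mu(y)<\infty$ and $(Kf)(x)=\int_X k(x,y)f(y)\,d\mu(y)$. A kernel operator is positive iff its kernel is non-negative almost everywhere. For positive kernel operators $K_1,\ldots,K_m$ on $L$ with kernels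 $k_1,\ldots,k_m$ and positive numbers $\alpha_1,\ldots,\alpha_m$ with $\sum_j\alpha_j=1$, $K_1^{(\alpha_1)}\circ\cdots\circ K_m^{(\alpha_m)}$ is the kernel operator with kernel $k_1(x,y)^{\alpha_1}\cdots k_m(x,y)^{\alpha_m}$; it is a positive kernel operator defined on all of $L$. The ordinary product $A_1A_2\cdots A_m$ is composition, and $\rho$ denotes the spectral radius. Sequence space case: let $R$ be either $\{1,\ldots,n\}$ for some $n\in\mathbb{N}$ or $\mathbb{N}$. A Banach sequence space is a Banach function space over $R$ with counting measure, i.e. a Banach space $L$ of complex sequences $(x_i)_{i\in R}$ such that if $x$ is a sequence indexed by $R$, $y\in L$ and $|x|\le|y|$ coordinatewise, then $x\in L$ and $\|x\|_L\le\|y\|_L$. $\mathcal{L}$ is the collection of all Banach sequence spaces $L$ such that $e_i=\chi_{\{i\}}\in L$ and $\|e_i\|_L=1$ for all $i\in R$. A non-negative matrix $A=[a_{ij}]_{i,j\in R}$ (possibly infinite, $a_{ij}\ge0$) defines an operator on $L$ if $Ax\in L$ for all $x\in L$, where $(Ax)_i=\sum_{j\in R}a_{ij}x_j$; this operator is positive and bounded. The Hadamard product is $A\circ B=[a_{ij}b_{ij}]_{i,j\in R}$; for $L\in\mathcal{L}$ Hadamard products of non-negative matrices defining operators on $L$ again define operators on $L$. *)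

(* Defs.v *)
From HB Require Import structures.
From mathcomp Require Import all_boot all_order all_algebra.
From mathcomp Require Import complex.
From mathcomp Require Import all_classical all_reals all_analysis.

Set Implicit Arguments.
Unset Strict Implicit.
Unset Printing Implicit Defensive.
Import Order.TTheory GRing.Theory Num.Theory.
Import numFieldNormedType.Exports.

Local Open Scope classical_set_scope.
Local Open Scope ring_scope.
Local Open Scope complex_scope.
Local Open Scope card_scope.

Section ComplexMeasurable.
Context d (X : measurableType d) (R : realType).

(* R[i] carries no measurableType structure in the library; its Borel
   sigma-algebra is the product one on R * R. *)
Definition cmeasurable (f : X -> R[i]) : Prop :=
  measurable_fun setT (fun x => complex.Re (f x)) /\
  measurable_fun setT (fun x => complex.Im (f x)).

Variable mu : {measure set X -> \bar R}.

Definition cabs_integrable (f : X -> R[i]) : Prop :=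
  (\int[mu]_x (Normc.normc (f x))%:E < +oo)%E.

Definition cintegral (f : X -> R[i]) : R[i] :=
  (\int[mu]_x complex.Re (f x))%R +i* (\int[mu]_x complex.Im (f x))%R.

End ComplexMeasurable.

(* The subspace L of the space M(X, mu) of a.e.-classes is given as a Banach
   space bfs_space together with an injective linear map into M(X, mu); this
   map is presented by a representative [bfs_repr f] of the class of each
   f \in L, so that its linearity and injectivity are stated a.e.  On R[i] the
   relation z <= w means that w - z is a nonnegative real number. *)
Record banachFunctionSpace d (X : measurableType d) (R : realType)
    (mu : {measure set X -> \bar R}) := BanachFunctionSpace {
  bfs_space :> completeNormedModType R[i] ;
  bfs_repr : bfs_space -> X -> R[i] ;
  bfs_measurable : forall f, cmeasurable (bfs_repr f) ;
  bfs_linear : forall (a : R[i]) (f g : bfs_space),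
    {ae mu, forall x, bfs_repr (a *: f + g) x = a * bfs_repr f x + bfs_repr g x} ;
  bfs_inj : forall f g : bfs_space,
    {ae mu, forall x, bfs_repr f x = bfs_repr g x} -> f = g ;
  bfs_ideal : forall (f : bfs_space) (g : X -> R[i]), cmeasurable g ->
    {ae mu, forall x, `|g x| <= `|bfs_repr f x|} ->
    exists h : bfs_space,
      {ae mu, forall x, bfs_repr h x = g x} /\ `|h| <= `|f| ;
  bfs_full : forall Y : set X, measurable Y ->
    (forall f, {ae mu, forall x, Y x -> bfs_repr f x = 0}) -> mu Y = 0%E
}.

Section Operators.
Context d (X : measurableType d) (R : realType).
Variables (mu : {measure set X -> \bar R}) (L : banachFunctionSpace mu).

Definition positive_operator (A : {linear L -> L}) : Prop :=
  forall f : L, {ae mu, forall x, 0 <= bfs_repr f x} ->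
    {ae mu, forall x, 0 <= bfs_repr (A f) x}.

Definition has_kernel (A : {linear L -> L}) (k : X * X -> R[i]) : Prop :=
  cmeasurable k /\
  forall f : L, {ae mu, forall x,
    cabs_integrable mu (fun y => k (x, y) * bfs_repr f y) /\
    bfs_repr (A f) x = cintegral mu (fun y => k (x, y) * bfs_repr f y)}.

End Operators.

(* The kernel of K_1^(alpha_1) o ... o K_m^(alpha_m).  The kernels of positive
   kernel operators are nonnegative reals almost everywhere, so taking real
   parts only affects a null set. *)
Definition hadamard_wgm_kernel d (X : measurableType d) (R : realType) (m : nat)
    (alpha : 'I_m -> R) (k : 'I_m -> X * X -> R[i]) (z : X * X) : R[i] :=
  (\prod_(j < m) (complex.Re (k j z)) `^ (alpha j))%:C.

Section SpectralRadius.
Context (R : realType) (V : normedModType R[i]).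

Definition spectrum (T : V -> V) : set R[i] :=
  ~` [set l | exists S : {linear V -> V},
        [/\ continuous S,
            forall v, S (l *: v - T v) = v &
            forall v, l *: S v - T (S v) = v]].

(* [sup set0 = 0] covers V = 0, the only case where a bounded operator has
   empty spectrum. *)
Definition spectral_radius (T : V -> V) : R :=
  sup [set Normc.normc l | l in spectrum T].

End SpectralRadius.

(* A_1 A_2 ... A_m: A_m acts first. *)
Definition operator_product (V : Type) (m : nat) (A : 'I_m -> V -> V) : V -> V :=
  \big[comp/idfun]_(j < m) A j.

(* X is the index set {1, ..., n} or N, up to a relabelling of the indices. *)
Definition sequence_index d (X : measurableType d) : Prop :=
  (forall A : set X, measurable A) /\
  ((exists2 n : nat, (0 < n)%N & [set: X] #= `I_n) \/
   [set: X] #= [set: nat]).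

(* The collection of Banach sequence spaces whose unit vectors have norm 1;
   has_kernel is then the action of a matrix (k (i, j)) on sequences. *)
Definition normalized_sequence_space d (X : measurableType d) (R : realType)
    (mu : {measure set X -> \bar R}) (L : banachFunctionSpace mu) : Prop :=
  [/\ sequence_index X,
      (forall A : set X, mu A = counting A) &
      forall i : X, exists2 e : L,
        (forall j, bfs_repr e j = (j == i)%:R) & `|e| = 1].

(* Main.v *)
(* If u >= 0 satisfies P u <= s u for P = A_1 ... A_m and t^m = s, then u_m = u
   and t u_(j-1) = A_j u_j define a cyclic chain of inequalities A_j u_j <= t
     u_(j-1).
   By Hoelder's inequality the geometric mean w of the u_j satisfies G w <= t w,
   hence G^n w <= t^n w.  Every f >= 0 lies below such a w, with a norm control:
   u comes from the resolvent of P at s > rho(P), which is a positive operator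
   (real positive values of the resolvent parameter suffice, so no complex
   analysis is needed).  The Neumann series then gives rho(G) <= t.

   For sequence spaces the geometric mean is replaced by a product.  As the
   product of the u_j does not dominate f, this is done for each unit vector e_y
   separately, and the products W(., y) are then superposed:
   w = sum_y f(y) W(., y), which is in L because sequences in L are bounded.

   That the kernel of a positive operator is nonnegative almost everywhere is
   seen section by section: all sections of a product-measurable set belong to
   a common countably generated sigma-algebra, so the monotone class theorem
   only has to be fed with countably many null sets. *)
Require Import Defs.
From HB Require Import structures.
From mathcomp Require Import all_boot all_order all_algebra.
From mathcomp Require finmap.
From mathcomp Require Import complex.
From mathcomp Require Import all_classical all_reals all_analysis.
From mathcomp Require Import measurable_realfun.
From mathcomp Require Import ring lra.
Import Order.TTheory GRing.Theory Num.Theory.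
Import numFieldNormedType.Exports.
Set Implicit Arguments.
Unset Strict Implicit.
Unset Printing Implicit Defensive.
Local Open Scope classical_set_scope.
Local Open Scope ring_scope.
Local Open Scope complex_scope.

(** * Real-valued norms *)

(* The norm of a complex normed module takes its values in R[i]. *)
Section RealNorm.
Context (R : realType) (V : normedModType R[i]).
Implicit Types (u v w : V) (a : R[i]).

Definition rnorm v : R := complex.Re `|v|.

Lemma ge0_complexE a : 0 <= a -> a = (complex.Re a)%:C.
Proof. by case: a => x y; rewrite lecE /= => /andP[/eqP -> _]. Qed.

Lemma normE v : `|v| = (rnorm v)%:C.
Proof. exact/ge0_complexE/normr_ge0. Qed.

Lemma normc_def a : `|a| = (Normc.normc a)%:C.
Proof. by []. Qed.

Lemma rnorm_ge0 v : 0 <= rnorm v.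
Proof. by have := normr_ge0 v; rewrite normE lecR. Qed.

Lemma rnorm0 : rnorm 0 = 0.
Proof. by rewrite /rnorm normr0. Qed.

Lemma rnorm0_eq0 v : rnorm v <= 0 -> v = 0.
Proof.
move=> v0; apply/eqP; rewrite -normr_eq0 normE.
by have -> : rnorm v = 0 by apply/eqP; rewrite eq_le v0 rnorm_ge0.
Qed.

Lemma rnormN v : rnorm (- v) = rnorm v.
Proof. by rewrite /rnorm normrN. Qed.

Lemma rnormB u v : rnorm (u - v) = rnorm (v - u).
Proof. by rewrite /rnorm distrC. Qed.

Lemma rnormD u v : rnorm (u + v) <= rnorm u + rnorm v.
Proof. by have := ler_normD u v; rewrite !normE -rmorphD lecR. Qed.

Lemma rnorm_sum I (r : seq I) (F : I -> V) :
  rnorm (\sum_(i <- r) F i) <= \sum_(i <- r) rnorm (F i).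
Proof.
elim/big_ind2: _ => [|x u y v xu yv|//]; first by rewrite rnorm0.
by apply: (le_trans (rnormD _ _)); apply: lerD.
Qed.

Lemma rnormZ a v : rnorm (a *: v) = Normc.normc a * rnorm v.
Proof.
by rewrite {1}/rnorm normrZ normc_def normE -rmorphM.
Qed.

Lemma normcR (x : R) : Normc.normc x%:C = `|x|.
Proof. by rewrite /= expr0n addr0 sqrtr_sqr. Qed.

Lemma normc_ge0 (a : R[i]) : 0 <= Normc.normc a.
Proof. by have := normr_ge0 a; rewrite normc_def lecR. Qed.

Lemma normcX (a : R[i]) n : Normc.normc (a ^+ n) = Normc.normc a ^+ n.
Proof.
by elim: n => [|n IH]; rewrite ?Normc.normc1// !exprS Normc.normcM IH.
Qed.

Lemma rnormZR (x : R) v : rnorm (x%:C *: v) = `|x| * rnorm v.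
Proof. by rewrite rnormZ normcR. Qed.

Lemma gtc0_Re (e : R[i]) : 0 < e -> 0 < complex.Re e /\ e = (complex.Re e)%:C.
Proof.
move=> e0; have ee := ge0_complexE (ltW e0); split=> //.
by move: e0; rewrite {1}ee ltcR.
Qed.

Lemma bounded_continuous (T : {linear V -> V}) (C : R) :
  (forall v, rnorm (T v) <= C * rnorm v) -> continuous T.
Proof.
move=> TC; apply: bounded_linear_continuous; apply/linear_boundedP.
exists `|C|%:C; split; first (by apply: ger0_real; rewrite lecR).
move=> r Cr v.
rewrite !normE.
have r0 : 0 <= r by rewrite (le_trans _ (ltW Cr))// lecR.
rewrite (ge0_complexE r0) -rmorphM lecR (le_trans (TC v))//.
rewrite ler_wpM2r ?rnorm_ge0//.
move: Cr; rewrite (ge0_complexE r0) ltcR => /ltW; apply: le_trans; exact: ler_norm.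
Qed.

Lemma continuous_bounded (T : {linear V -> V}) : continuous T ->
  exists2 C : R, 0 < C & forall v, rnorm (T v) <= C * rnorm v.
Proof.
move=> /(_ 0)/continuous_linear_bounded/linear_boundedP [r [rr rP]].
have r1 : r < (complex.Re `|r| + 1)%:C.
  rewrite (le_lt_trans (real_ler_norm rr))//.
  by rewrite {1}(ge0_complexE (normr_ge0 r)) ltcR ltrDl.
exists (complex.Re `|r| + 1).
  by rewrite ltr_wpDl// -lecR -ge0_complexE ?normr_ge0.
by move=> v; have := rP _ r1 v; rewrite !normE -rmorphM lecR.
Qed.

End RealNorm.

(** The right-hand sides tend to 0. The norm estimates below use this bound in place of limits. *)
Lemma geometric_le0 (R : realType) (x C q : R) : 0 <= q < 1 ->
  (forall n, x <= C * q ^+ n) -> x <= 0.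
Proof.
move=> /andP[q0 q1] xC; rewrite leNgt; apply/negP => x0.
have : (fun n => C * q ^+ n) @ \oo --> C * 0.
  by apply: cvgMr; apply: cvg_expr; rewrite ger0_norm.
rewrite mulr0 => /cvgrPdist_lt/(_ _ x0)[n _ /(_ n (leqnn n))].
rewrite /= sub0r normrN => /(le_lt_trans (ler_norm _)).
by rewrite ltNge xC.
Qed.

(** * Sequences with geometrically decreasing increments *)

Section Complete.
Context (R : realType) (V : completeNormedModType R[i]).

(** Telescoping bounds every tail by a geometric sum, so the sequence is Cauchy. The explicit rate
    is what the later arguments use. *)
Lemma geometric_cvg (u : nat -> V) (C q : R) : 0 <= C -> 0 <= q < 1 ->
    (forall n, rnorm (u n.+1 - u n) <= C * q ^+ n) ->
  exists l, forall n, rnorm (l - u n) <= C * q ^+ n / (1 - q).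
Proof.
move=> C0 /andP[q0 q1] uC.
have q1' : 0 < 1 - q by rewrite subr_gt0.
have D n k : rnorm (u (n + k)%N - u n) <= C * q ^+ n / (1 - q).
  (* The sharper bound, with the tail of the geometric sum removed, is the one that goes through the
     induction on [k]. *)
  suff : rnorm (u (n + k)%N - u n) <= C * (q ^+ n - q ^+ (n + k)) / (1 - q).
    move=> /le_trans; apply; rewrite ler_pM2r ?invr_gt0// ler_wpM2l//.
    by rewrite gerBl exprn_ge0.
  elim: k => [|k IH]; first by rewrite addn0 !subrr rnorm0 mulr0 mul0r.
  rewrite addnS -(subrK (u (n + k)%N) (u (n + k).+1)) -addrA.
  apply: (le_trans (rnormD _ _)).
  apply: (le_trans (lerD (uC _) IH)).
  rewrite exprS le_eqVlt; apply/orP; left; apply/eqP; field.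
  by rewrite gt_eqF.
have small (e : R) : 0 < e -> exists n, C * q ^+ n / (1 - q) < e.
  move=> e0.
  have : (fun n => C / (1 - q) * q ^+ n) @ \oo --> C / (1 - q) * 0.
    by apply: cvgMr; apply: cvg_expr; rewrite ger0_norm.
  rewrite mulr0 => /cvgrPdist_lt/(_ e e0)[n _ /(_ n (leqnn n))].
  rewrite /= sub0r normrN => H; exists n; rewrite mulrAC.
  exact: le_lt_trans (ler_norm _) H.
have cu : cvg (u @ \oo).
  apply/cauchy_cvgP/cauchy_exP => e e0.
  have [re0 ee] := gtc0_Re e0.
  have [n Hn] := small _ re0.
  exists (u n), n => // k /= nk.
  rewrite -ball_normE /ball_ /= normE ee ltcR rnormB.
  by rewrite -(subnKC nk); apply: le_lt_trans Hn.
move/cvg_ex: cu => [l ul]; exists l => n.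
rewrite leNgt; apply/negP => H; pose e := rnorm (l - u n) - C * q ^+ n / (1 - q).
have e0 : 0 < e%:C by rewrite ltcR /e subr_gt0.
move/cvgrPdist_lt: ul => /(_ _ e0)[N _ /(_ (n + N)%N (leq_addl _ _))].
rewrite /= normE ltcR => HN.
have := rnormD (l - u (n + N)%N) (u (n + N)%N - u n).
have := D n N.
rewrite addrA subrK; rewrite /e in HN; move=> a b.
have : rnorm (l - u n) < rnorm (l - u n) - C * q ^+ n / (1 - q)
  + C * q ^+ n / (1 - q).
  by apply: (le_lt_trans b); apply: ltr_leD.
by rewrite subrK ltxx.
Qed.

End Complete.

(** * Linear operators and their spectrum *)

Lemma linear_bundle (R : pzRingType) (U V : lmodType R) (f : U -> V) :
  linear f -> exists g : {linear U -> V}, (g : U -> V) = f.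
Proof.
move=> lin.
pose g : {linear U -> V} := HB.pack f (GRing.isLinear.Build _ _ _ _ f lin).
by exists g.
Qed.

Section Resolvent.
Context (R : realType) (V : completeNormedModType R[i]).
Implicit Types (T : {linear V -> V}) (l : R[i]).

(** Injectivity makes the chosen solutions unique, hence linear in [v]; the norm bound makes the
    resulting inverse of l - T continuous. *)
Lemma bijective_notin_spectrum T l (C : R) :
    (forall v, exists2 x, l *: x - T x = v & rnorm x <= C * rnorm v) ->
    (forall x, l *: x = T x -> x = 0) ->
  ~ spectrum T l.
Proof.
move=> ex inj; apply; have [s sP] := choice (fun v =>
  let: ex_intro2 x h1 h2 := ex v in ex_intro _ x (conj h1 h2)).
have uniq x y : l *: x - T x = l *: y - T y -> x = y.
  move=> /eqP; rewrite -subr_eq0 => /eqP H; apply/eqP; rewrite -subr_eq0.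
  apply/eqP/inj/eqP; rewrite -subr_eq0 -[X in _ == X]H scalerBr linearB /=.
  by rewrite !opprD !opprK addrACA.
have [S SE] : exists g : {linear V -> V}, (g : V -> V) = s.
  apply: linear_bundle => a u v; apply: uniq;
    rewrite (sP _).1 linearP [T _]linearP /=.
  rewrite -[in LHS](sP u).1 -[in LHS](sP v).1 scalerBr.
  by rewrite opprD addrACA.
exists S; split.
- by apply: (@bounded_continuous _ _ _ C) => v; rewrite SE (sP v).2.
- by move=> v; apply: uniq; rewrite SE (sP _).1.
- by move=> v; rewrite SE (sP _).1.
Qed.

(** The Neumann series solves l x - T x = v. For injectivity, l x = T x yields l^n x = T^n x, which
    is compatible with the power bound only if x = 0. *)
Lemma power_bounded_notin_spectrum T l (C r : R) : 0 <= C ->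
    0 <= r < Normc.normc l ->
    (forall n v, rnorm (iter n T v) <= C * r ^+ n * rnorm v) ->
  ~ spectrum T l.
Proof.
move=> C0 /andP[r0 rl] TC.
have l0 : 0 < Normc.normc l by exact: le_lt_trans rl.
have lnz : l != 0 by apply: contraTneq l0 => ->; rewrite Normc.normc0 ltxx.
pose q := r / Normc.normc l.
have q01 : 0 <= q < 1 by rewrite divr_ge0 ?normc_ge0//= ltr_pdivrMr// mul1r.
apply: (@bijective_notin_spectrum _ _ (C / Normc.normc l / (1 - q))); last first.
  move=> x xT.
  have iT n : l ^+ n *: x = iter n T x.
    elim: n => [|n IH]; first by rewrite scale1r.
    by rewrite iterS -IH linearZ /= -xT scalerA exprSr.
  apply: rnorm0_eq0; apply: (geometric_le0 q01 (C := C * rnorm x)) => n.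
  have ln0 : 0 < Normc.normc l ^+ n by rewrite exprn_gt0.
  rewrite /q expr_div_n mulrA ler_pdivlMr// mulrC -normcX -rnormZ iT.
  by apply: (le_trans (TC n x)); rewrite mulrAC.
move=> v.
(* The partial sums of sum_k l^(-k-1) T^k v, written as the iteration of x = l^-1 (v + T x) from
   0. *)
pose u := fix u n := if n is k.+1 then l^-1 *: (v + T (u k)) else 0.
have uS n : u n.+1 - u n = l^-1 ^+ n.+1 *: iter n T v.
  elim: n => [|n IH]; first by rewrite /= linear0 addr0 subr0 expr1.
  have -> : u n.+2 = l^-1 *: (v + T (u n.+1)) by [].
  rewrite [X in _ - X](_ : _ = l^-1 *: (v + T (u n)))//.
  rewrite -scalerBr opprD addrACA subrr add0r -linearB IH linearZ /=.
  by rewrite scalerA -exprS.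
have [||x xP] := @geometric_cvg _ _ u (C * rnorm v / Normc.normc l) q _ q01.
  by rewrite divr_ge0 ?normc_ge0// mulr_ge0// rnorm_ge0.
  move=> n; rewrite uS rnormZ normcX Normc.normcV.
  apply: (le_trans (ler_wpM2l _ (TC n v)));
    first by rewrite exprn_ge0// invr_ge0 normc_ge0.
  rewrite /q expr_div_n exprS exprVn le_eqVlt; apply/orP; left; apply/eqP.
  by field; rewrite expf_neq0// gt_eqF.
exists x; last first.
  have := xP 0%N; rewrite /= subr0 expr0 mulr1 => /le_trans; apply.
  by rewrite le_eqVlt; apply/orP; left; apply/eqP; ring.
pose B := C * rnorm v / Normc.normc l / (1 - q).
have B0 : 0 <= B.
  by rewrite /B !divr_ge0 ?normc_ge0// ?mulr_ge0 ?rnorm_ge0// subr_ge0 ltW;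
    case/andP: q01.
suff H n : rnorm (l *: x - T x - v) <= (Normc.normc l + C * r) * B * q ^+ n.
  apply/eqP; rewrite -subr_eq0; apply/eqP/rnorm0_eq0.
  exact: geometric_le0 q01 H.
(* By l u_(n+1) = v + T u_n the residual depends only on the errors x - u_(n+1) and x - u_n. *)
have -> : l *: x - T x - v = l *: (x - u n.+1) - T (x - u n).
  have lu : l *: u n.+1 = v + T (u n) by rewrite /= scalerA mulfV// scale1r.
  by rewrite scalerBr linearB lu /= !opprD !opprK addrACA subrK.
apply: (le_trans (rnormD _ _)); rewrite rnormN rnormZ.
rewrite -mulrA mulrDl; apply: lerD.
  apply: ler_wpM2l; first exact: normc_ge0.
  apply: (le_trans (xP _)); rewrite mulrAC -/B ler_wpM2l//.
  case/andP: q01 => q0 q1; by rewrite exprS ler_piMl ?exprn_ge0// ltW.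
have := TC 1%N (x - u n); rewrite expr1 /= => /le_trans; apply.
apply: ler_wpM2l; first by rewrite mulr_ge0.
by apply: (le_trans (xP _)); rewrite mulrAC.
Qed.

End Resolvent.

(** * Positive operators *)

(* The last field writes v = p_0 + i p_1 - p_2 - i p_3, where all the parts lie
   below an element a playing the role of |v|. *)
Record normal_cone (R : realType) (V : completeNormedModType R[i])
    (K : V -> Prop) : Prop := {
  cone0 : K 0 ;
  coneD : forall u v, K u -> K v -> K (u + v) ;
  coneZ : forall (x : R) v, 0 <= x -> K v -> K (x%:C *: v) ;
  cone_le : forall u v, K u -> K (v - u) -> rnorm u <= rnorm v ;
  cone_closed : forall v,
    (forall e : R, 0 < e -> exists2 u, K u & rnorm (v - u) <= e) -> K v ;
  cone_decomp : forall v, exists2 a, rnorm a <= rnorm v &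
    exists2 p : 'I_4 -> V, (forall i, K (p i) /\ K (a - p i)) &
      v = \sum_(i < 4) 'i%C ^+ i *: p i
}.

Section Cone.
Context (R : realType) (V : completeNormedModType R[i]) (K : V -> Prop).
Hypothesis coneK : normal_cone K.

Definition positive (T : V -> V) := forall v, K v -> K (T v).

(** A positive T maps each of the four parts of v between 0 and T a, and the coefficients i^k have
    modulus 1; whence the factor 4. *)
Lemma cone_dominating v : exists2 a, K a /\ rnorm a <= rnorm v &
  forall T : {linear V -> V}, positive T -> rnorm (T v) <= 4 * rnorm (T a).
Proof.
have [a av [p pK vE]] := cone_decomp coneK v; exists a.
  split=> //; have [p0 ap0] := pK ord0.
  by rewrite -(subrK (p ord0) a); apply: coneD.
move=> T T0; rewrite vE linear_sum /=.
have B i : rnorm (T ('i%C ^+ val i *: p i)) <= rnorm (T a).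
  rewrite linearZ rnormZ normcX /= expr0n expr1n add0r sqrtr1 expr1n mul1r.
  apply: (cone_le coneK); first exact/T0/(pK _).1.
  by rewrite -linearB; apply/T0/(pK _).2.
apply: (le_trans (rnorm_sum _ _));
  apply: (@le_trans _ _ (\sum_(i < 4) rnorm (T a))).
  by apply: ler_sum => i _; exact: B.
by rewrite sumr_const card_ord mulr_natl.
Qed.

(* Otherwise there are f_n >= 0 with norms at most 2^-n and |T f_n| >= 2^n, which
   contradicts T f_n <= T (sum_n f_n). *)
Lemma positive_bounded (T : {linear V -> V}) : positive T ->
  exists2 C : R, 0 <= C & forall v, rnorm (T v) <= C * rnorm v.
Proof.
move=> T0.
suff [C C0 TC] : exists2 C : R, 0 <= C &
    forall v, K v -> rnorm (T v) <= C * rnorm v.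
  exists (4 * C); first by rewrite mulr_ge0.
  move=> v; have [a [Ka av] /(_ _ T0) Ta] := cone_dominating v.
  by rewrite (le_trans Ta)// -mulrA ler_wpM2l// (le_trans (TC _ Ka))// ler_wpM2l.
apply: contrapT => noC.
have H n : exists f, [/\ K f, rnorm f <= 2^-1 ^+ n & 2 ^+ n <= rnorm (T f)].
  (* If the bound 4^n fails at v, the multiple of v of norm 2^-n has an image of norm at least
     2^n. *)
  apply: contrapT => nf; apply: noC; exists (4 ^+ n); first exact: exprn_ge0.
  move=> v Kv; rewrite leNgt; apply/negP => vT; apply: nf.
  have v0 : 0 < rnorm v.
    rewrite lt_neqAle rnorm_ge0 andbT eq_sym; apply: contraTneq vT => v0.
    have -> : v = 0 by apply: rnorm0_eq0; rewrite v0.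
    by rewrite linear0 rnorm0 mulr0 ltxx.
  have c0 : 0 <= 2^-1 ^+ n / rnorm v by rewrite divr_ge0 ?exprn_ge0 ?ltW.
  exists ((2^-1 ^+ n / rnorm v)%:C *: v); split.
  - exact: coneZ.
  - by rewrite rnormZR ger0_norm// divfK// gt_eqF.
  - rewrite linearZ rnormZR ger0_norm// -(ler_pM2r v0) mulrAC divfK ?gt_eqF//.
    rewrite exprVn ler_pdivlMl ?exprn_gt0// mulrA -exprMn.
    by rewrite (_ : 2 * 2 = 4) ?ltW//; ring.
have {H}[f fP] := choice H.
pose s := fix s n := if n is k.+1 then s k + f k else 0.
have [|||l lP] := @geometric_cvg _ _ s 1 2^-1.
- exact: ler01.
- by apply/andP; split; lra.
- by move=> n /=; rewrite [s n + _]addrC addrK mul1r; case: (fP n).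
have sub n k : K (s (n + k)%N - s n).
  elim: k => [|k IH]; first by rewrite addn0 subrr; apply: cone0.
  rewrite addnS /= addrAC; apply: coneD => //; by case: (fP (n + k)%N).
(* This is the limit of the partial sums with the term [f n] removed, which lie in the cone. *)
have lf n : K (l - f n).
  apply: (cone_closed coneK) => e e0.
  have [k ke] : exists k, 2^-1 ^+ k / (1 - 2^-1) <= e.
    apply: contrapT => ke; have q01 : 0 <= (2^-1 : R) < 1 by apply/andP; split; lra.
    suff : e <= 0 by rewrite leNgt e0.
    apply: (geometric_le0 q01 (C := (1 - 2^-1)^-1)) => n0; rewrite leNgt;
      apply/negP => H; apply: ke; exists n0.
    by rewrite mulrC ltW.
  exists (s (n.+1 + k)%N - f n).
    rewrite -(subrK (s n.+1) (s (n.+1 + k)%N)) -addrA; apply: coneD => //.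
    by rewrite /= addrK; have := sub 0%N n; rewrite add0n subr0.
  rewrite opprB addrA subrK; apply: (le_trans (lP _)); apply: le_trans ke.
  rewrite mul1r ler_pM2r; last by rewrite invr_gt0; lra.
  rewrite exprD ler_piMl ?exprn_ge0//; apply: exprn_ile1; lra.
have Tl n : 2 ^+ n <= rnorm (T l).
  have [fK _ /le_trans] := fP n; apply.
  apply: (cone_le coneK); first exact: T0.
  by rewrite -linearB; apply/T0/lf.
suff : (1 : R) <= 0 by rewrite leNgt ltr01.
apply: (@geometric_le0 _ _ (rnorm (T l)) 2^-1); first by apply/andP; split; lra.
move=> n; rewrite exprVn -(ler_pM2r (_ : 0 < 2 ^+ n)) ?exprn_gt0//.
by rewrite mul1r divfK ?gt_eqF ?exprn_gt0.
Qed.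

(** The iterates of v |-> b + T v from 0 stay in the closed cone and converge to its fixed point x,
    because T is a contraction. *)
Lemma cone_fixpoint (T : {linear V -> V}) (q : R) b x : positive T ->
    0 <= q < 1 -> (forall v, rnorm (T v) <= q * rnorm v) ->
  K b -> x = b + T x -> K x.
Proof.
move=> T0 q01 Tq Kb xE.
pose y := fix y n := if n is k.+1 then b + T (y k) else 0.
have Ky n : K (y n).
  elim: n => [|n IH]; first exact: cone0.
  by apply: coneD => //; apply: T0.
have xy n : rnorm (x - y n) <= rnorm x * q ^+ n.
  elim: n => [|n IH]; first by rewrite subr0 mulr1.
  rewrite /= {1}xE opprD addrACA subrr add0r -linearB (le_trans (Tq _))//.
  by rewrite exprS mulrCA ler_wpM2l//; case/andP: q01.
apply: (cone_closed coneK) => e e0.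
have [k ke] : exists k, rnorm x * q ^+ k <= e.
  apply: contrapT => ke; suff : e <= 0 by rewrite leNgt e0.
  apply: (geometric_le0 q01 (C := rnorm x)) => n; rewrite leNgt; apply/negP => H;
    apply: ke.
  by exists n; rewrite ltW.
by exists (y k) => //; apply: le_trans (xy k) ke.
Qed.

End Cone.

(** * Spectral radius and resolvent of a positive operator *)

Section PositiveSpectrum.
Context (R : realType) (V : completeNormedModType R[i]) (K : V -> Prop).
Hypothesis coneK : normal_cone K.

Lemma spectral_radius_ge0 (T : V -> V) : 0 <= spectral_radius T.
Proof.
rewrite /spectral_radius; set E := [set _ | _ in _].
(* [sup] is 0 on a set without supremum. *)
have [[[x Ex] ubE]|/sup_out -> //] := pselect (has_sup E).
by apply: (le_trans _ (ub_le_sup ubE Ex)); case: Ex => l _ <-; exact: normc_ge0.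
Qed.

Lemma linear_iter (T : {linear V -> V}) n :
  exists S : {linear V -> V}, (S : V -> V) = iter n T.
Proof.
apply: linear_bundle => a u v; elim: n => [//|n IH].
by rewrite !iterS IH linearP.
Qed.

Lemma positive_iter (T : V -> V) n : positive K T -> positive K (iter n T).
Proof. by move=> T0 v Kv; elim: n => [//|n IH]; apply: T0. Qed.

(** Positivity gives T^n f <= T^n w <= t^n w, so the powers of T are bounded by a multiple of t^n,
    and no l with |l| > t is spectral. *)
Lemma spectral_radius_le_supersolution (T : {linear V -> V}) (t C : R) :
    positive K T -> 0 <= t -> 0 <= C ->
    (forall f, K f -> exists w,
      [/\ K (w - f), K (t%:C *: w - T w) & rnorm w <= C * rnorm f]) ->
  spectral_radius T <= t.
Proof.
move=> T0 t0 C0 super.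
have iterK f n : K f -> rnorm (iter n T f) <= C * t ^+ n * rnorm f.
  move=> Kf; have [w [wf tw wC]] := super f Kf.
  have [S SE] := linear_iter T n.
  have S0 : positive K S by rewrite SE; exact: positive_iter.
  apply: (@le_trans _ _ (rnorm (iter n T w))).
    apply: (cone_le coneK); first exact: positive_iter.
    by rewrite -SE -linearB; exact: S0.
  have Kw : K w by rewrite -(subrK f w); apply: (coneD coneK).
  apply: (@le_trans _ _ (rnorm ((t ^+ n)%:C *: w))); last first.
    by rewrite rnormZR ger0_norm ?exprn_ge0// mulrAC mulrC ler_wpM2r// exprn_ge0.
  apply: (cone_le coneK); first exact: positive_iter.
  elim: (n) => [|k IH]; first by rewrite scale1r subrr; exact: (cone0 coneK).
  rewrite -(subrK (T ((t ^+ k)%:C *: w)) (_ *: w)) -addrA; apply: (coneD coneK).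
    rewrite exprSr rmorphM -scalerA [T _]linearZ /= -scalerBr.
    by apply: (coneZ coneK) => //; exact: exprn_ge0.
  by rewrite iterS -linearB; exact: T0.
have iterT v n : rnorm (iter n T v) <= 4 * C * t ^+ n * rnorm v.
  have [a [Ka av] H] := cone_dominating coneK v.
  have [S SE] := linear_iter T n.
  have := H S; rewrite SE => /(_ (positive_iter n T0)) /le_trans; apply.
  rewrite -!mulrA ler_wpM2l// (le_trans (iterK _ _ Ka))// -mulrA !ler_wpM2l//.
  exact: exprn_ge0.
have bound : ubound [set Normc.normc l | l in spectrum T] t.
  move=> _ [l lT <-]; rewrite leNgt; apply/negP => tl.
  have := @power_bounded_notin_spectrum _ _ T l (4 * C) t.
  by apply=> //; rewrite ?t0 ?mulr_ge0.
have [S0|] := eqVneq [set Normc.normc l | l in spectrum T] set0.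
  by rewrite /spectral_radius S0 sup0.
by move=> /set0P S0; apply: ge_sup.
Qed.

(** Since T is bounded, so is its spectrum; the [sup] is then a genuine upper bound, and s lies
    above it. *)
Lemma resolvent_exists (T : {linear V -> V}) (s : R) : positive K T ->
    spectral_radius T < s ->
  exists S : {linear V -> V},
    [/\ continuous S, forall v, S (s%:C *: v - T v) = v &
        forall v, s%:C *: S v - T (S v) = v].
Proof.
move=> T0 sT; apply: contrapT => nS.
have [C C0 TC] := positive_bounded coneK T0.
have iterT v n : rnorm (iter n T v) <= 1 * C ^+ n * rnorm v.
  rewrite mul1r; elim: n => [|n IH]; first by rewrite mul1r.
  by rewrite iterS (le_trans (TC _))// exprS -mulrA ler_wpM2l.
have bound : has_ubound [set Normc.normc l | l in spectrum T].
  exists C => _ [l lT <-]; rewrite leNgt; apply/negP => tl.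
  have := @power_bounded_notin_spectrum _ _ T l 1 C.
  by apply=> //; rewrite ?C0.
have : Normc.normc (s%:C) <= spectral_radius T by apply: ub_le_sup => //;
  exists s%:C.
rewrite normcR => /(le_trans (ler_norm s)).
by rewrite leNgt sT.
Qed.

(* Let a be the infimum of the l >= s with positive resolvent.  The resolvents at
   l near a are uniformly bounded, so positivity at some l >= a passes to all
   smaller parameters near a: S_r v solves x = S_l v + (l - r) S_l x, a contraction
   of the cone.  Hence a = s. *)
Lemma resolvent_positive (T : {linear V -> V}) (s : R) : positive K T ->
    spectral_radius T < s ->
  exists2 S : {linear V -> V}, positive K S &
    forall v, s%:C *: S v - T (S v) = v.
Proof.
move=> T0 sT; have s0 : 0 < s := le_lt_trans (spectral_radius_ge0 T) sT.
have [C C0 TC] := positive_bounded coneK T0.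
have ex (l : R) : s <= l -> exists S : {linear V -> V},
    [/\ continuous S, forall v, S (l%:C *: v - T v) = v &
        forall v, l%:C *: S v - T (S v) = v].
  by move=> sl; apply: resolvent_exists => //; apply: lt_le_trans sl.
pose E := [set l : R | s <= l /\ exists2 S : {linear V -> V}, positive K S &
    (forall v, S (l%:C *: v - T v) = v) /\ forall v, l%:C *: S v - T (S v) = v].
suff : E s by move=> [_ [S S0 [_ SP]]]; exists S.
(* The resolvent identity, in the form S_m v = S_l v + (l - m) S_l S_m v. *)
have resE (S : {linear V -> V}) (l m : R) v y :
    (forall v, S (l%:C *: v - T v) = v) -> m%:C *: y - T y = v ->
    y = S v + (l - m)%:C *: S y.
  move=> Sl <-; have {1}-> : y = S (l%:C *: y - T y) by rewrite Sl.
  rewrite -[_ *: S y]linearZ -linearD; congr (S _).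
  by rewrite rmorphB scalerBl [RHS]addrC addrA subrK.
(* At this parameter T / (s + 2 C) contracts by 1/2, so the solution lies in the cone. *)
have Ene : E (s + 2 * C).
  have sC : s <= s + 2 * C by rewrite lerDl mulr_ge0.
  have l0 : 0 < s + 2 * C by apply: lt_le_trans sC.
  split=> //; have [S [_ SP1 SP2]] := ex _ sC.
  exists S => // v Kv.
  apply: (@cone_fixpoint _ _ _ coneK
    ((s + 2 * C)^-1%:C \*: T) 2^-1 ((s + 2 * C)^-1%:C *: v)) => //.
  - move=> u Ku /=; apply: (coneZ coneK); first by rewrite invr_ge0 ltW.
    exact: T0.
  - by apply/andP; split; lra.
  - move=> u /=; rewrite rnormZR ger0_norm ?invr_ge0 ?(ltW l0)//.
    rewrite ler_pdivrMl// (le_trans (TC u))// mulrA ler_wpM2r ?rnorm_ge0//.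
    by rewrite mulrDl mulrAC mulfV// mul1r lerDr mulr_ge0// ltW.
  - by apply: (coneZ coneK) => //; rewrite invr_ge0 ltW.
  - have lS : (s + 2 * C)%:C *: S v = v + T (S v) by apply/eqP;
    rewrite -subr_eq SP2.
    by rewrite /= -scalerDr -lS scalerA -rmorphM /= mulVf ?gt_eqF// scale1r.
have Elb : has_lbound E by exists s => l [].
have sa : s <= inf E by apply: lb_le_inf; [exists (s + 2 * C) | move=> l []].
have [A [Ac A1 A2]] := ex _ sa.
have [B B0 AB] := continuous_bounded Ac.
(* Within [dl] of [inf E] the resolvents are bounded by 2 B, and lowering the parameter by at most 2
   [dl] contracts by 2 [dl] times 2 B, which is 1/2. *)
pose dl := (8 * B)^-1.
have d0 : 0 < dl by rewrite invr_gt0 mulr_gt0.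
have [l [sl [S S0 [S1 S2]]] la] := inf_adherent d0 (conj (ex_intro _ _ Ene) Elb).
have al : inf E <= l by apply: ge_inf => //; split=> //; exists S.
have SB v : rnorm (S v) <= 2 * B * rnorm v.
  have := resE _ _ _ v (S v) A1 (S2 v) => H.
  have : rnorm (S v) <= B * rnorm v + dl * (B * rnorm (S v)).
    rewrite {1}H; apply: (le_trans (rnormD _ _)); apply: lerD; first exact: AB.
    rewrite rnormZR; apply: ler_pM => //; first exact: rnorm_ge0.
    by rewrite distrC ger0_norm ?subr_ge0// lerBlDl ltW.
  rewrite /dl invfM mulrA mulfVK ?gt_eqF// => H1.
  have := rnorm_ge0 (S v); lra.
pose m := Num.max s (inf E - dl).
have sm : s <= m by rewrite le_max lexx.
have [Q [_ Q1 Q2]] := ex _ sm.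
have [lm|ml] := ltP l m.
  have : inf E - dl < l by apply: lt_le_trans al; rewrite ltrBlDr ltrDl.
  move=> H; move: lm; rewrite /m lt_max => /orP[|/ltW]; first by rewrite ltNge sl.
  by rewrite leNgt H.
have Em : E m.
  split=> //; exists Q => // v Kv.
  have lmd : l - m <= 2 * dl.
    have : inf E - dl <= m by rewrite le_max lexx orbT.
    by move=> H; lra.
  apply: (@cone_fixpoint _ _ _ coneK ((l - m)%:C \*: S) 2^-1 (S v)).
  - by move=> u Ku /=; apply: (coneZ coneK); rewrite ?subr_ge0//; exact: S0.
  - by apply/andP; split; lra.
  - move=> u /=; rewrite rnormZR ger0_norm ?subr_ge0//.
    apply: (@le_trans _ _ (2 * dl * (2 * B * rnorm u))).
      by apply: ler_pM; rewrite ?subr_ge0 ?rnorm_ge0.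
    rewrite /dl invfM le_eqVlt; apply/orP; left; apply/eqP; field.
    by rewrite gt_eqF.
  - exact: S0.
  - exact: (resE _ _ _ v (Q v) S1 (Q2 v)).
(* Otherwise [m = inf E - dl] would be an element of [E] below its infimum. *)
have ms : m = s.
  apply: max_l; have := ge_inf Elb Em; rewrite le_max => /orP[|]; lra.
by rewrite -ms.
Qed.

End PositiveSpectrum.

(** * The cyclic system of equations *)

Section CyclicSystem.
Context (R : realType) (V : completeNormedModType R[i]) (K : V -> Prop).
Hypothesis coneK : normal_cone K.
Context (m : nat) (A : 'I_m -> {linear V -> V}) (t : R).
Hypotheses (A_ge0 : forall j, positive K (A j)) (t_gt0 : 0 < t).

Lemma operator_product_positive :
  exists2 P : {linear V -> V}, positive K P &
    (P : V -> V) = operator_product (fun j => A j : V -> V).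
Proof.
rewrite /operator_product; elim/big_ind: _ => [|f g [P P0 <-] [Q Q0 <-]|j _].
- by exists (idfun : {linear V -> V}).
- by exists (P \o Q : {linear V -> V}) => // v Kv; apply/P0/Q0.
- by exists (A j).
Qed.

(* [A] extended to all natural indices, with the identity as junk value. *)
Let A' (i : nat) : {linear V -> V} :=
  if insub i is Some j then A j else (idfun : {linear V -> V}).

Let A'E (j : 'I_m) : A' j = A j.
Proof. by rewrite /A' valK. Qed.

Let A'_ge0 i : positive K (A' i).
Proof. by rewrite /A'; case: insub => [j|v //]; exact: A_ge0. Qed.

(* The chain t u_j = A_j u_(j+1) + f solved downwards from u_m = u: the value at
   [k] is u_(m-k).  Closing the chain, u_0 = u_m, is a resolvent equation for the
   product of the A_j. *)
Let back := fix back k (u f : V) :=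
  if k is k'.+1 then t^-1%:C *: (A' (m - k) (back k' u f) + f) else u.

Let backP k a u u' f f' :
  back k (a *: u + u') (a *: f + f') = a *: back k u f + back k u' f'.
Proof.
elim: k => [//|k IH] /=; rewrite IH linearP /= !scalerDr !scalerA [a * _]mulrC.
by rewrite addrACA.
Qed.

Let back_ge0 k u f : K u -> K f -> K (back k u f).
Proof.
move=> Ku Kf; elim: k => [//|k IH] /=.
apply: (coneZ coneK); first by rewrite invr_ge0 ltW.
by apply: (coneD coneK) => //; exact: A'_ge0.
Qed.

Let back_prod k u : (k <= m)%N -> back k u 0 =
  ((t^-1) ^+ k)%:C *: (\big[comp/idfun]_(m - k <= i < m) (A' i : V -> V)) u.
Proof.
elim: k => [_|k IH km]; first by rewrite subn0 big_geq// scale1r.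
rewrite /= addr0 IH ?(ltnW km)// linearZ /= scalerA -rmorphM -exprS.
rewrite [in RHS]big_ltn; last by rewrite ltn_subrL; case: (m) km.
by rewrite -subSn//.
Qed.

(** The source f in each equation makes every t T_j f dominate f. Linearity and positivity of the
    T_j make them bounded, which later gives the norm control. *)
Lemma cyclic_system :
    spectral_radius (operator_product (fun j => A j : V -> V)) < t ^+ m ->
  exists T : nat -> {linear V -> V},
    [/\ forall j, positive K (T j), (T 0%N : V -> V) = T m &
        forall (j : 'I_m) f, t%:C *: T j f = A j (T j.+1 f) + f].
Proof.
have [P P0 PE] := operator_product_positive; rewrite -PE => Pt.
have [S S0 SP] := resolvent_positive coneK P0 Pt.
(* Closing the chain requires u = t^-m P u + [back m 0 f], that is, (t^m - P) u = t^m
   [back m 0 f]. *)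
pose u f := S ((t ^+ m)%:C *: back m 0 f).
have uP a f g : u (a *: f + g) = a *: u f + u g.
  have := backP m a 0 0 f g; rewrite scaler0 addr0 /u => ->.
  by rewrite scalerDr linearD scalerA mulrC -scalerA linearZ.
have [T TP] : exists T : nat -> {linear V -> V},
    forall j f, T j f = back (m - j) (u f) f.
  have /choice [T TP] : forall j, exists g : {linear V -> V},
      (g : V -> V) = fun f => back (m - j) (u f) f.
    by move=> j; apply: linear_bundle => a f g; rewrite uP backP.
  by exists T => j f; rewrite TP.
have u_ge0 f : K f -> K (u f).
  move=> Kf; apply: S0; apply: (coneZ coneK); first by rewrite exprn_ge0// ltW.
  by apply: back_ge0 => //; exact: (cone0 coneK).
exists T; split.
- by move=> j f Kf; rewrite TP; apply: back_ge0 => //; exact: u_ge0.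
- apply/funext => f; rewrite !TP subn0 subnn /=.
  have -> : back m (u f) f = back m (u f) 0 + back m 0 f.
    by have := backP m 1 (u f) 0 0 f; rewrite !scale1r addr0 add0r.
  rewrite back_prod// subnn big_mkord.
  under eq_bigr do rewrite A'E.
  rewrite -[\big[_/_]_(_ < _) _]PE.
  have tm : t ^+ m != 0 by rewrite expf_neq0// gt_eqF.
  apply: (scalerI (a := (t ^+ m)%:C)); first by rewrite eq_complex /= negb_and tm.
  rewrite scalerDr scalerA -rmorphM exprVn mulfV// scale1r.
  by apply/eqP; rewrite eq_sym addrC -subr_eq; apply/eqP; exact: SP.
- move=> j f; rewrite !TP -A'E.
  have -> : (m - j = (m - j.+1).+1)%N by rewrite -subSn.
  rewrite /= scalerA -rmorphM mulfV ?gt_eqF// scale1r.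
  by rewrite -subSn// subSS subKn// ltnW.
Qed.

End CyclicSystem.

(** * The cone of a Banach function space *)

Section FunctionSpaceCone.
Context d (X : measurableType d) (R : realType) (mu : {measure set X -> \bar R}).
Variable L : banachFunctionSpace mu.
Implicit Types (f g h : L).
Local Notation repr := (@bfs_repr d X R mu L).

Definition bfs_ge0 (f : L) : Prop := {ae mu, forall x, 0 <= repr f x}.

Lemma bfs_reprD f g :
  {ae mu, forall x, repr (f + g) x = repr f x + repr g x}.
Proof.
have := bfs_linear 1 f g; rewrite scale1r.
by apply: filterS => x ->; rewrite mul1r.
Qed.

Lemma bfs_repr0 : {ae mu, forall x, repr (0 : L) x = 0}.
Proof.
have := bfs_reprD 0 0; rewrite addr0.
by apply: filterS => x /eqP; rewrite -subr_eq0 opprD addNKr oppr_eq0 => /eqP.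
Qed.

Lemma bfs_reprZ a f : {ae mu, forall x, repr (a *: f) x = a * repr f x}.
Proof.
have := bfs_linear a f 0; rewrite addr0 => H.
by apply: filterS2 H bfs_repr0 => x -> ->; rewrite addr0.
Qed.

Lemma bfs_reprB f g :
  {ae mu, forall x, repr (f - g) x = repr f x - repr g x}.
Proof.
apply: filterS2 (bfs_reprD f (- g)) (bfs_reprZ (-1) g) => x ->.
by rewrite scaleN1r mulN1r => ->.
Qed.

Lemma bfs_repr_sum I (r : seq I) (F : I -> L) : {ae mu, forall x,
  repr (\sum_(i <- r) F i) x = \sum_(i <- r) repr (F i) x}.
Proof.
elim: r => [|i r IH].
  by apply: filterS bfs_repr0 => x; rewrite !big_nil.
rewrite big_cons; apply: filterS2 (bfs_reprD (F i) (\sum_(j <- r) F j)) IH.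
by move=> x -> ->; rewrite big_cons.
Qed.

Lemma bfs_ideal_real f (g : X -> R[i]) : cmeasurable g ->
    {ae mu, forall x, `|g x| <= `|repr f x|} ->
  exists2 h, {ae mu, forall x, repr h x = g x} & rnorm h <= rnorm f.
Proof.
move=> mg gf; have [h [hg hf]] := bfs_ideal mg gf; exists h => //.
by rewrite -lecR -!normE.
Qed.

Lemma bfs_norm_le f g :
  {ae mu, forall x, `|repr f x| <= `|repr g x|} -> rnorm f <= rnorm g.
Proof.
by move=> /(bfs_ideal_real (bfs_measurable f))[h /bfs_inj ->].
Qed.

Lemma normc_le (a b : R[i]) : `|complex.Re a| <= `|complex.Re b| ->
  `|complex.Im a| <= `|complex.Im b| -> `|a| <= `|b|.
Proof.
case: a b => [x y] [u v] /= xu yv; rewrite !normc_def lecR /=.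
apply: ler_wsqrtr; apply: lerD.
  by rewrite -[leLHS]real_normK ?num_real// -[leRHS]real_normK ?num_real//
    lerXn2r// nnegrE.
by rewrite -[leLHS]real_normK ?num_real// -[leRHS]real_normK ?num_real// lerXn2r//
  nnegrE.
Qed.

Lemma cmeasurable_real (w : X -> R) : measurable_fun setT w ->
  cmeasurable (fun x => (w x)%:C).
Proof. by move=> mw; split => //=; exact: measurable_cst. Qed.

(** The function [w] joins the negative part of Re f and Im f. It is dominated by |f - g| for every
    g >= 0, so its norm is below every e and it vanishes. *)
Let ge0_closed f :
  (forall e : R, 0 < e -> exists2 g, bfs_ge0 g & rnorm (f - g) <= e) -> bfs_ge0 f.
Proof.
move=> fg; have [mRe mIm] := bfs_measurable f.
pose w x := Complex (Num.max 0 (- complex.Re (repr f x)))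
  (complex.Im (repr f x)).
have mw : cmeasurable w.
  by split => //; apply: measurable_maxr => //; exact: measurableT_comp.
have [h hw _] : exists2 h, {ae mu, forall x, repr h x = w x} & rnorm h <= rnorm f.
  apply: bfs_ideal_real => //; apply: filterE => x; apply: normc_le => //=.
  rewrite ger0_norm ?le_max ?lexx// ge_max normr_ge0/= -normrN ler_norm//.
suff h0 : h = 0.
  move: hw; rewrite h0 => hw; apply: filterS2 hw bfs_repr0 => x -> /eqP.
  rewrite eq_complex /= => /andP[/eqP fR /eqP fI]; rewrite lecE /= fI eqxx /=.
  by rewrite -oppr_le0 -[leRHS]fR le_max lexx orbT.
apply: rnorm0_eq0; apply/ler_addgt0Pr => e /fg[g g0 fge]; rewrite add0r.
apply: le_trans fge; apply: bfs_norm_le.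
apply: filterS3 hw (bfs_reprB f g) g0 => x -> ->.
case: (repr g x) => a b; rewrite lecE /= => /andP[/eqP b0 a0].
rewrite b0 /w; case: (repr f x) => u v; apply: normc_le => /=;
  last by rewrite subr0.
rewrite ger0_norm ?le_max ?lexx// ge_max normr_ge0/= -normrN.
by apply: le_trans (ler_norm _); rewrite opprB lerBrDr addNr.
Qed.

(** Here a is the class of max(|Re f|, |Im f|), and the p_i are the positive parts of Re f, Im f,
    -Re f and -Im f, in the order of the powers of i. *)
Let ge0_decomp f : exists2 a : L, rnorm a <= rnorm f &
  exists2 p : 'I_4 -> L, (forall i, bfs_ge0 (p i) /\ bfs_ge0 (a - p i)) &
    f = \sum_(i < 4) 'i%C ^+ i *: p i.
Proof.
have [mRe mIm] := bfs_measurable f.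
pose c (i : 'I_4) (z : R[i]) : R := nth 0
  [:: complex.Re z; complex.Im z; - complex.Re z; - complex.Im z] i.
pose M x : R := Num.max `|complex.Re (repr f x)| `|complex.Im (repr f x)|.
have mM : cmeasurable (fun x => (M x)%:C).
  by apply/cmeasurable_real/measurable_maxr; exact: measurableT_comp.
have M_ge0 x : 0 <= M x by rewrite le_max normr_ge0.
have [a aM af] : exists2 a, {ae mu, forall x, repr a x = (M x)%:C} & rnorm a <=
  rnorm f.
  apply: bfs_ideal_real => //; apply: filterE => x.
  rewrite ger0_norm ?lecR// ge_max.
  case: (repr f x) => u v /=; rewrite -!sqrtr_sqr.
  by rewrite !ler_wsqrtr// ?lerDl ?lerDr sqr_ge0.
exists a => //.
have cM i x : Num.max 0 (c i (repr f x)) <= M x.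
  rewrite ge_max M_ge0/= /M; case: (repr f x) => u v.
  by case: i => [[|[|[|[|//]]]] ?] /=; rewrite le_max !ler_normr lexx ?orbT.
have /choice [p pc] : forall i : 'I_4, exists g, {ae mu, forall x,
    repr g x = (Num.max 0 (c i (repr f x)))%:C}.
  move=> i;
    have [||h hc _] := @bfs_ideal_real a (fun x => (Num.max 0 (c i (repr f
    x)))%:C); last by exists h.
    apply/cmeasurable_real/measurable_maxr => //.
    by case: i => [[|[|[|[|//]]]] ?] //=; exact: measurableT_comp.
  apply: filterS aM => x ->; rewrite !ger0_norm ?lecR // ?le_max ?lexx//.
exists p.
  move=> i; split; first by apply: filterS (pc i) => x ->; rewrite lecR le_max lexx.
  apply: filterS3 aM (pc i) (bfs_reprB a (p i)) => x -> -> ->.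
  by rewrite subr_ge0 lecR.
have Z : {ae mu, forall x, forall i : 'I_4,
    repr ('i%C ^+ i *: p i) x = 'i%C ^+ i * repr (p i) x}.
  by apply: filter_forall => i; exact: bfs_reprZ.
have P : {ae mu, forall x, forall i : 'I_4,
    repr (p i) x = (Num.max 0 (c i (repr f x)))%:C}.
  by apply: filter_forall.
have S := bfs_repr_sum (index_enum 'I_4) (fun i => 'i%C ^+ i *: p i).
apply: bfs_inj; apply: filterS3 S Z P => x -> Z P.
under eq_bigr do rewrite Z P.
rewrite !big_ord_recl big_ord0 /c /=.
case: (repr f x) => u v; apply/eqP; rewrite eq_complex /=.
have pm (y : R) : Num.max 0 y - Num.max 0 (- y) = y.
  by have [y0|y0] := leP 0 y; have [y1|y1] := leP 0 (- y); lra.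
by apply/andP; split; apply/eqP; have := pm u; have := pm v; lra.
Qed.

Lemma bfs_normal_cone : normal_cone bfs_ge0.
Proof.
split.
- by apply: filterS bfs_repr0 => x ->.
- move=> f g f0 g0; apply: filterS3 (bfs_reprD f g) f0 g0 => x -> *.
  exact: addr_ge0.
- move=> a f a0 f0; apply: filterS2 (bfs_reprZ a%:C f) f0 => x -> *.
  by rewrite mulr_ge0// lecR.
- move=> f g f0 gf0; apply: bfs_norm_le; apply: filterS3 (bfs_reprB g f) f0 gf0.
  move=> x -> f0 /[!subr_ge0] fg.
  by rewrite !ger0_norm// (le_trans f0).
- exact: ge0_closed.
- exact: ge0_decomp.
Qed.


End FunctionSpaceCone.

(** * Nonnegativity of kernels *)

(** The sets with this property form a sigma-algebra containing the rectangles, whose sections are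
    empty or one fixed side. *)
Lemma sections_countably_generated d1 d2 (T1 : measurableType d1)
    (T2 : measurableType d2) (E : set (T1 * T2)) : measurable E ->
  exists2 Y : nat -> set T2, forall n, measurable (Y n) &
    forall x, <<s range Y >> (xsection E x).
Proof.
pose G := [set E : set (T1 * T2) | exists2 Y : nat -> set T2,
  forall n, measurable (Y n) & forall x, <<s range Y >> (xsection E x)].
suff : @measurable _ (T1 * T2)%type `<=` G by apply.
have sG : sigma_algebra setT G.
  split.
  - by exists (fun _ => set0) => // x; rewrite xsection0; exact: sigma_algebra0.
  - move=> A [Y mY YA]; exists Y => // x; rewrite xsectionD.
    have -> : xsection [set: T1 * T2] x = setT by rewrite xsectionE preimage_setT.
    exact: sigma_algebraCD.
  - move=> F FG.
    have {FG} /choice [Y YP] : forall n, exists Y : nat -> set T2,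
        (forall i, measurable (Y i)) /\ forall x, <<s range Y >> (xsection (F n) x).
      by move=> n; have [Y] := FG n; exists Y.
    (* The generators of all [F i] are pooled into one sequence by coding pairs; numbers that code
       no pair give the empty set. *)
    exists (fun n => if unpickle n is Some (i, j) then Y i j else set0).
      by move=> n; case: unpickle => [[i j]|//]; exact: (YP i).1.
    move=> x; rewrite xsection_bigcup; apply: sigma_algebra_bigcup => i.
    have := (YP i).2 x; apply: sub_sigma_algebra2 => _ [j _ <-].
    by exists (pickle (i, j)) => //; rewrite pickleK.
rewrite measurable_prod_measurableType.
apply: smallest_sub => // _ [A mA [B mB <-]].
exists (fun=> B) => // x; have [xA|xA] := boolP (x \in A).
  by rewrite in_xsectionX//; apply: sub_sigma_algebra; exists 0%N.
by rewrite notin_xsectionX//; exact: sigma_algebra0.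
Qed.

Section CountableAlgebra.
Context (T : Type) (Y : nat -> set T).

(* Nodes are read as complements of intersections, so that the values of this
   function form the countable algebra of sets generated by the [Y n]. *)
Fixpoint nand_tree (t : GenTree.tree nat) : set T :=
  match t with
  | GenTree.Leaf n => Y n
  | GenTree.Node _ ts => ~` foldr (fun s A => nand_tree s `&` A) setT ts
  end.

Let neg (t : GenTree.tree nat) := GenTree.Node 0 [:: t].

Let negE t : nand_tree (neg t) = ~` nand_tree t.
Proof. by rewrite /= setIT. Qed.

Let nandE s t : nand_tree (GenTree.Node 0 [:: s; t]) =
  ~` (nand_tree s `&` nand_tree t).
Proof. by rewrite /= setIT. Qed.

Lemma setring_nand_tree : setring (range nand_tree).
Proof.
split.
- by exists (GenTree.Node 0 [::]) => //=; rewrite setCT.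
- move=> _ _ [s _ <-] [t _ <-].
  by exists (GenTree.Node 0 [:: neg s; neg t]) => //;
    rewrite nandE !negE -setCU setCK.
- move=> _ _ [s _ <-] [t _ <-].
  by exists (neg (GenTree.Node 0 [:: s; neg t])) => //;
    rewrite negE nandE negE setCK setDE.
Qed.

(** The whole space is among the tree sets, so the sigma-ring they generate is closed under
    complements. *)
Lemma sub_g_sigma_ring_nand_tree : <<s range Y >> `<=` <<sr range nand_tree >>.
Proof.
have [r0 rD rU] := smallest_sigma_ring (range nand_tree).
apply: smallest_sub; last first.
  by move=> _ [n _ <-]; apply: sub_g_sigma_ring; exists (GenTree.Leaf n).
split => // A rA; apply: rD => //; apply: sub_g_sigma_ring.
by exists (neg (GenTree.Node 0 [::])) => //; rewrite negE /= setCT setC0.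
Qed.

End CountableAlgebra.

Lemma measurable_nand_tree d (X : measurableType d) (Y : nat -> set X) t :
  (forall n, measurable (Y n)) -> measurable (nand_tree Y t).
Proof.
move=> mY; elim/GenTree.tree_ind: t => [n|n ts IH] /=; first exact: mY.
apply: measurableC; elim: ts IH => [_|t ts IHts] /=; first exact: measurableT.
move=> [mt /IHts mts].
exact: measurableI.
Qed.

Section ChargeMonotone.
Context d (X : measurableType d) (R : realType) (mu : {measure set X -> \bar R}).

(* The sets of nonnegative charge form a monotone class. *)
Lemma ge0_integral_g_sigma_algebra (Y : nat -> set X) (phi : X -> R) (E : set X) :
    (forall n, measurable (Y n)) -> mu.-integrable setT (EFin \o phi) ->
    (forall t, 0 <= \int[mu]_(x in nand_tree Y t) (phi x)%:E)%E ->
    <<s range Y >> E ->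
  (0 <= \int[mu]_(x in E) (phi x)%:E)%E.
Proof.
move=> mY iphi phi0 YE.
pose G := [set A | measurable A /\ 0 <= \int[mu]_(x in A) (phi x)%:E]%E.
suff : <<s range Y >> `<=` G by move=> /(_ _ YE) [].
apply: (subset_trans (@sub_g_sigma_ring_nand_tree _ Y)).
apply: (@monotone_setring_sub_g_sigma_ring _ G); last 2 first.
- exact: setring_nand_tree.
- by move=> _ [t _ <-]; split; [exact: measurable_nand_tree|exact: phi0].
(* Increasing unions and decreasing intersections are both eventually constant at each point;
   dominated convergence by |phi| handles them together. *)
have lim (F : nat -> set X) A : (forall n, G (F n)) -> measurable A ->
    (forall x, exists N, forall n, (N <= n)%N -> F n x <-> A x) -> G A.
  move=> GF mA FA; split=> //; have mphi := measurable_int _ iphi.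
  have iabs : mu.-integrable setT (abse \o (EFin \o phi)) by exact: integrable_abse.
  have mF n : measurable (F n) by have [] := GF n.
  have [|||||_ _] := @dominated_convergence _ _ _ mu setT measurableT
    (fun n => (EFin \o phi) \_ (F n)) ((EFin \o phi) \_ A) (abse \o (EFin \o phi)).
  - by move=> n; apply/(measurable_restrictT _ (mF n));
    exact: measurable_funTS mphi.
  - by apply/(measurable_restrictT _ mA); exact: measurable_funTS mphi.
  - apply: aeW => x _; have [N NP] := FA x; apply: cvg_near_cst.
    exists N => // n /= Nn; rewrite !patchE.
    suff -> : (x \in F n) = (x \in A) by [].
    by apply/idP/idP => /set_mem H; apply/mem_set; apply/(NP n Nn).
  - exact: iabs.
  - by apply: aeW => x n _ /=; rewrite patchE; case: ifP => //= _;
    rewrite normr0 lee_fin.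
  rewrite -integral_mkcond => h.
  rewrite -(cvg_lim _ h)//; apply: lime_ge; first by apply/cvg_ex; eexists;
    exact: h.
  by apply: nearW => n; rewrite /= -integral_mkcond; have [] := GF n.
split=> F mF GF.
- apply: (lim F) => //; first by apply: bigcup_measurable => n _; have [] := GF n.
  move=> x; have [[N _ FN]|nF] := pselect ((\bigcup_i F i) x).
    exists N => n Nn; split=> [Fn|_]; first by exists n.
    by have /subsetPset := mF _ _ Nn; apply.
  by exists 0%N => n _; split=> // Fn; exists n.
- apply: (lim F) => //; first by apply: bigcapT_measurable => n; have [] := GF n.
  move=> x; have [IF|nF] := pselect ((\bigcap_i F i) x).
    by exists 0%N => n _; split=> // _; exact: IF.
  have [N NF] : exists N, ~ F N x.
    by apply: contrapT => H; apply: nF => n _; apply: contrapT => Fn; apply: H;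
      exists n.
  exists N => n Nn; split=> // Fn; exfalso; apply: NF.
  by have /subsetPset := mF _ _ Nn; apply.
Qed.

End ChargeMonotone.

Lemma cmeasurable_mul d (X : measurableType d) (R : realType) (f g : X -> R[i]) :
  cmeasurable f -> cmeasurable g -> cmeasurable (fun x => f x * g x).
Proof.
move=> [fR fI] [gR gI]; split.
  rewrite (_ : (fun x => _) = fun x => complex.Re (f x) * complex.Re (g x)
    - complex.Im (f x) * complex.Im (g x)).
    by apply: measurable_funB; exact: measurable_funM.
  by apply/funext => x; case: (f x) (g x) => [a b] [c d'].
rewrite (_ : (fun x => _) = fun x => complex.Re (f x) * complex.Im (g x)
  + complex.Im (f x) * complex.Re (g x)).
  by apply: measurable_funD; exact: measurable_funM.
by apply/funext => x; case: (f x) (g x) => [a b] [c d'].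
Qed.

Lemma measurable_normc d (X : measurableType d) (R : realType) (f : X -> R[i]) :
  cmeasurable f -> measurable_fun setT (fun x => Normc.normc (f x)).
Proof.
move=> [fR fI].
rewrite (_ : (fun x => _) = Num.sqrt \o
  (fun x => complex.Re (f x) ^+ 2 + complex.Im (f x) ^+ 2)).
  apply: measurableT_comp.
    by apply: continuous_measurable_fun; exact: sqrt_continuous.
  by apply: measurable_funD; exact: measurable_funX.
by apply/funext => x /=; case: (f x).
Qed.

Lemma cmeasurable_section d1 d2 (X : measurableType d1) (Y : measurableType d2)
    (R : realType) (k : X * Y -> R[i]) x :
  cmeasurable k -> cmeasurable (fun y => k (x, y)).
Proof.
by move=> [kR kI]; split;
  [exact: (measurable_fun_pair2 (f := fun z => complex.Re (k z)))
  |exact: (measurable_fun_pair2 (f := fun z => complex.Im (k z)))].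
Qed.

Section Kernel.
Context d (X : measurableType d) (R : realType) (mu : {measure set X -> \bar R}).
Context (L : banachFunctionSpace mu) (A : {linear L -> L}) (k : X * X -> R[i]).
Hypothesis Ak : has_kernel A k.
Local Notation repr := (@bfs_repr d X R mu L).

(** A real argument separates the real and imaginary parts of the kernel, and |Re k| |w| <= |k w|
    transfers integrability. *)
Lemma kernel_real (f : L) (w : X -> R) : measurable_fun setT w ->
    {ae mu, forall x, repr f x = (w x)%:C} ->
  {ae mu, forall x, [/\
    mu.-integrable setT (EFin \o (fun y => complex.Re (k (x, y)) * w y)),
    complex.Re (repr (A f) x) = \int[mu]_y (complex.Re (k (x, y)) * w y) &
    complex.Im (repr (A f) x) = \int[mu]_y (complex.Im (k (x, y)) * w y)]}.
Proof.
move=> mw fw; have [mk kA] := Ak; apply: filterS (kA f) => x [kf ->].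
have mkx := cmeasurable_section x mk.
have [mR mI] := mkx.
have mkf : cmeasurable (fun y => k (x, y) * repr f y).
  by apply: cmeasurable_mul => //; exact: bfs_measurable.
have mRw : measurable_fun setT (fun y => complex.Re (k (x, y)) * w y).
  exact: measurable_funM.
split.
- apply/integrableP; split; first exact/measurable_EFinP.
  apply: le_lt_trans kf; apply: ae_ge0_le_integral => //=.
  + by apply/measurable_EFinP; exact: measurableT_comp.
  + by move=> y _; rewrite lee_fin normc_ge0.
  + by apply/measurable_EFinP; exact: measurable_normc.
  + apply: filterS fw => y -> _; rewrite lee_fin Normc.normcM normcR normrM.
    rewrite ler_wpM2r//; case: (k (x, y)) => a b /=.
    by rewrite -sqrtr_sqr ler_wsqrtr// lerDl sqr_ge0.
- congr fine; apply: ae_eq_integral => //.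
  + by apply/measurable_EFinP; case: mkf.
  + exact/measurable_EFinP.
  + by apply: filterS fw => y -> _; congr EFin; case: (k (x, y)) => a b /=;
    rewrite mulr0 subr0.
- congr fine; apply: ae_eq_integral => //.
  + by apply/measurable_EFinP; case: mkf.
  + by apply/measurable_EFinP; exact: measurable_funM.
  + by apply: filterS fw => y -> _; congr EFin; case: (k (x, y)) => a b /=;
    rewrite mulr0 add0r.
Qed.

(** Testing A on w restricted to countably many sets shows that, for almost every x, the charge with
    density Re k(x, .) w is nonnegative on a sigma-algebra containing the section of {Re k < 0}. The
    weight w keeps the test functions in L. *)
Lemma kernel_ge0 (f : L) (w : X -> R) : positive_operator A ->
    measurable_fun setT w -> (forall x, 0 <= w x) ->
    {ae mu, forall x, repr f x = (w x)%:C} ->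
  {ae mu, forall x, {ae mu, forall y, 0 <= complex.Re (k (x, y)) * w y}}.
Proof.
move=> A0 mw w0 fw; have [mk _] := Ak; have [mkR _] := mk.
pose E := [set z | complex.Re (k z) < 0].
have mE : measurable E.
  rewrite -[E]setTI; exact: measurable_fun_ltr.
have [Y mY YE] := sections_countably_generated mE.
have pos t : {ae mu, forall x,
    (0 <= \int[mu]_(y in nand_tree Y t) (complex.Re (k (x, y)) * w y)%:E)%E}.
  have mB : measurable (nand_tree Y t) by exact: measurable_nand_tree.
  pose v y := w y * \1_(nand_tree Y t) y.
  have v0 y : 0 <= v y by rewrite mulr_ge0.
  have mv : measurable_fun setT v by exact: measurable_funM.
  have [||g gv _] := @bfs_ideal_real _ _ _ _ L f (fun y => (v y)%:C).
  - exact: cmeasurable_real.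
  - apply: filterS fw => y ->; rewrite !ger0_norm ?lecR//.
    by rewrite /v ler_piMr// indicE lern1 leq_b1.
  have Ag : {ae mu, forall x, 0 <= repr (A g) x}.
    by apply: A0; apply: filterS gv => y ->; rewrite lecR.
  apply: filterS2 Ag (kernel_real mv gv) => x Agx [iv Rv _].
  have : 0 <= complex.Re (repr (A g) x) by move: Agx; case: (repr _ _) => a b;
    rewrite lecE => /andP[].
  rewrite Rv integral_mkcond.
  rewrite (_ : (fun y => _)%E \_ _ = fun y => (complex.Re (k (x, y)) * v y)%:E).
    by rewrite -lee_fin /Rintegral fineK//; exact: integrable_fin_num.
  apply/funext => y; rewrite patchE /v indicE.
  by case: (y \in _); rewrite ?mulr1// !mulr0.
(* The trees are countable, so a single null set of x serves for all of them. *)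
have {}pos : {ae mu, forall x, forall n, if unpickle n is Some t then
    (0 <= \int[mu]_(y in nand_tree Y t) (complex.Re (k (x, y)) * w y)%:E)%E else
      true}.
  by apply: ae_foralln => n; case: unpickle => [t|]; [exact: pos|exact: aeW].
apply: filterS2 pos (kernel_real mw fw) => x posx [iw _ _].
set phi := fun y => complex.Re (k (x, y)) * w y in iw *.
have Ex : (0 <= \int[mu]_(y in xsection E x) (phi y)%:E)%E.
  apply: (ge0_integral_g_sigma_algebra mY) => // t.
  by have := posx (pickle t); rewrite pickleK.
have mEx : measurable (xsection E x) by exact: measurable_xsection.
have mphi : measurable_fun (xsection E x) (EFin \o phi).
  by apply: measurable_funTS; case/integrableP : iw.
(* On this section [phi] is at most 0 while its integral is at least 0, so it vanishes almost
   everywhere there. *)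
have : ae_eq mu (xsection E x) (EFin \o phi) (cst 0%E).
  apply/ae_eq_integral_abs => //; apply/eqP; rewrite eq_le integral_ge0// andbT.
  rewrite -oppe_ge0 -integral_ge0N// (eq_integral (EFin \o phi))// => y;
    rewrite inE.
  move=> /xsectionP /= ky; rewrite ler0_norm ?opprK// /phi.
  by rewrite mulr_le0_ge0// ltW.
apply: filterS => y; have [ky _|ky] := leP 0 (complex.Re (k (x, y))).
  exact: mulr_ge0.
by move=> phi0; rewrite -/(phi y) [phi y](EFin_inj (phi0 _))//; exact/xsectionP.
Qed.

End Kernel.

(** * Geometric means *)

Lemma prod_shift (R : comPzRingType) m (F : nat -> R) : F 0%N = F m ->
  \prod_(j < m) F j = \prod_(j < m) F j.+1.
Proof.
case: m => [|m] F0; first by rewrite !big_ord0.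
by rewrite big_ord_recl big_ord_recr /= -F0 mulrC.
Qed.

Section GeometricMean.
Context (R : realType) (m : nat) (m_gt0 : (0 < m)%N).
Implicit Types a b : 'I_m -> R.

Definition gmean a : R := \prod_(j < m) (a j) `^ (m%:R^-1).

Let m_neq0 : m%:R != 0 :> R. Proof. by rewrite pnatr_eq0 -lt0n. Qed.

Let minv_neq0 : m%:R^-1 != 0 :> R. Proof. by rewrite invr_eq0. Qed.

Lemma gmean_ge0 a : 0 <= gmean a.
Proof. by apply: prodr_ge0 => j _; exact: powR_ge0. Qed.

Lemma powR_rootK (x : R) : 0 <= x -> (x `^ (m%:R^-1)) ^+ m = x.
Proof. by move=> x0; rewrite -powR_mulrn ?powR_ge0// -powRrM mulVf// powRr1. Qed.

Lemma gmean_exp a : (forall j, 0 <= a j) -> gmean a ^+ m = \prod_(j < m) a j.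
Proof.
by move=> a0; rewrite /gmean -prodrXl; apply: eq_bigr => j _; rewrite powR_rootK.
Qed.

Lemma gmean_le a b : (forall j, 0 <= a j) -> (forall j, a j <= b j) ->
  gmean a <= gmean b.
Proof.
move=> a0 ab; apply: ler_prod => j _; rewrite powR_ge0 /=.
by apply: ge0_ler_powR; rewrite ?nnegrE ?invr_ge0//; apply: le_trans (ab j).
Qed.

(** Only the products are assumed nonnegative: a kernel value a_j is uncontrolled where b_j = 0, but
    there both sides have a zero factor. *)
Lemma gmeanM a b : (forall j, 0 <= b j) -> (forall j, 0 <= a j * b j) ->
  gmean (fun j => a j * b j) = gmean a * gmean b.
Proof.
move=> b0 ab0; rewrite /gmean -big_split; apply: eq_bigr => j _ /=.
have [bj|bj] := eqVneq (b j) 0; first by rewrite bj mulr0 powR0// mulr0.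
have bj0 : 0 < b j by rewrite lt_neqAle eq_sym bj b0.
by rewrite powRM// -(pmulr_lge0 _ bj0).
Qed.

Lemma gmean_const (c : R) : 0 <= c -> gmean (fun=> c) = c.
Proof. by move=> c0; rewrite /gmean prodr_const card_ord powR_rootK. Qed.

Lemma gmean_shift (F : nat -> R) : F 0%N = F m ->
  gmean (fun j => F j) = gmean (fun j => F j.+1).
Proof. by move=> F0; apply: (@prod_shift _ _ (fun j => F j `^ _)); rewrite F0. Qed.

Lemma gmean0 a i : a i = 0 -> gmean a = 0.
Proof. by move=> ai; rewrite /gmean (bigD1 i)//= ai powR0// mul0r. Qed.

Lemma gmean_le_sum a : (forall j, 0 <= a j) ->
  gmean a <= m%:R^-1 * \sum_(j < m) a j.
Proof.
move=> a0; rewrite -(@ler_pXn2r _ m)// ?nnegrE ?gmean_ge0//; last first.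
  by rewrite mulr_ge0 ?invr_ge0// sumr_ge0.
rewrite gmean_exp//; have := (leif_AGM (A := 'I_m) (E := a) (fun i _ => a0 i)).1.
rewrite card_ord mulrC.
by rewrite (eq_bigl predT)// [X in (_ * X) ^+ _](eq_bigl predT).
Qed.

Lemma measurable_gmean d (X : measurableType d) (D : set X) (a : 'I_m -> X -> R) :
  (forall j, measurable_fun D (a j)) ->
  measurable_fun D (fun x => gmean (a ^~ x)).
Proof.
move=> ma; apply: measurable_prod => j _.
exact: (measurableT_comp (measurable_powR _) (ma j)).
Qed.

(* Weighting the arithmetic-geometric mean inequality by the integrals [I j]
   turns the bound into an equality after integration. *)
Lemma integral_gmean_le d (X : measurableType d)
    (mu : {measure set X -> \bar R}) (a : 'I_m -> X -> R) :
    (forall j x, 0 <= a j x) ->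
    (forall j, mu.-integrable setT (EFin \o a j)) ->
  \int[mu]_x gmean (a ^~ x) <= gmean (fun j => \int[mu]_x a j x).
Proof.
move=> a0 ia; pose I j := \int[mu]_x a j x.
have I0 j : 0 <= I j by apply: Rintegral_ge0 => x _.
have ma j : measurable_fun setT (a j).
  by apply/measurable_EFinP; case/integrableP : (ia j).
have IE j : (\int[mu]_x (a j x)%:E = (I j)%:E)%E.
  by rewrite /I /Rintegral fineK//; apply: integrable_fin_num => //; exact: ia.
(* The weights divide by the integrals. If some integral is 0, that factor, and hence the geometric
   mean, vanishes almost everywhere. *)
have [[i Ii]|Ineq0] := pselect (exists i, I i = 0).
  suff -> : \int[mu]_x gmean (a ^~ x) = 0 by exact: gmean_ge0.
  rewrite /Rintegral (ae_eq_integral (cst 0%E))//.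
  - by rewrite integral0.
  - by apply/measurable_EFinP; exact: measurable_gmean.
  have : ae_eq mu setT (EFin \o a i) (cst 0%E).
    apply/ae_eq_integral_abs => //; first exact/measurable_EFinP.
    under eq_integral do rewrite /= ger0_norm//.
    by rewrite IE Ii.
  by apply: filterS => x /(_ Logic.I) [ai0] _ /=; rewrite (gmean0 ai0).
have {Ineq0} I_gt0 j : 0 < I j.
  by rewrite lt_neqAle I0 andbT eq_sym; apply/eqP => Ij; apply: Ineq0; exists j.
pose c j := gmean I / m%:R / I j.
have c0 j : 0 <= c j by rewrite !divr_ge0// gmean_ge0.
have le_c x : gmean (a ^~ x) <= \sum_(j < m) c j * a j x.
  have aE : gmean (a ^~ x) = gmean I * gmean (fun j => a j x / I j).
    rewrite -gmeanM//; last 2 first.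
      by move=> j; rewrite divr_ge0.
      by move=> j; rewrite mulr_ge0// divr_ge0.
    by congr gmean; apply/funext => j; rewrite mulrC divfK ?gt_eqF.
  rewrite aE (le_trans (ler_wpM2l (gmean_ge0 _) (gmean_le_sum _)))//.
    by move=> j; rewrite divr_ge0.
  rewrite mulrA mulr_sumr le_eqVlt; apply/orP; left; apply/eqP/eq_bigr => j _.
  by rewrite /c; ring.
have mg : measurable_fun setT (fun x => gmean (a ^~ x)) by exact: measurable_gmean.
have : (\int[mu]_x (gmean (a ^~ x))%:E <= (gmean I)%:E)%E.
  apply: (@le_trans _ _ (\int[mu]_x (\sum_(j < m) c j * a j x)%:E)%E).
    apply: ge0_le_integral => //.
    - by move=> x _; rewrite lee_fin gmean_ge0.
    - exact/measurable_EFinP.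
    - apply/measurable_EFinP; apply: measurable_sum => j.
      exact: measurable_funM.
    - by move=> x _; rewrite lee_fin.
  under eq_integral do rewrite -sumEFin.
  rewrite ge0_integral_sum//; last first.
  - by move=> j x _; rewrite lee_fin mulr_ge0.
  - by move=> j; apply/measurable_EFinP; exact: measurable_funM.
  rewrite (eq_bigr (fun j => (gmean I / m%:R)%:E)); last first.
    move=> j _; under eq_integral do rewrite EFinM.
    rewrite ge0_integralZl_EFin//; last 2 first.
    - by move=> x _; rewrite lee_fin.
    - exact/measurable_EFinP.
    by rewrite IE -EFinM /c divfK ?gt_eqF.
  by rewrite sumEFin sumr_const card_ord -[_ / _ *+ _]mulr_natr divfK.
move=> H; rewrite -lee_fin /Rintegral fineK// ge0_fin_numE.
  by apply: le_lt_trans H _; rewrite ltry.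
by apply: integral_ge0 => x _; rewrite lee_fin gmean_ge0.
Qed.

End GeometricMean.

Section NonnegativePart.
Context d (X : measurableType d) (R : realType) (mu : {measure set X -> \bar R}).
Context (L : banachFunctionSpace mu).
Local Notation repr := (@bfs_repr d X R mu L).

(** For f in the cone this is a real representative that is nonnegative everywhere, not only almost
    everywhere. *)
Definition nnpart (f : L) (x : X) : R := Num.max 0 (complex.Re (repr f x)).

Lemma nnpart_ge0 f x : 0 <= nnpart f x.
Proof. by rewrite le_max lexx. Qed.

Lemma measurable_nnpart f : measurable_fun setT (nnpart f).
Proof. by apply: measurable_maxr => //; case: (bfs_measurable f). Qed.

Lemma nnpartE f : bfs_ge0 f -> {ae mu, forall x, repr f x = (nnpart f x)%:C}.
Proof.
apply: filterS => x f0; rewrite /nnpart {1}(ge0_complexE f0) max_r//.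
by rewrite -lecR -ge0_complexE.
Qed.

Lemma nonneg_kernel_positive (A : {linear L -> L}) (k : X * X -> R) :
  has_kernel A (fun z => (k z)%:C) -> (forall z, 0 <= k z) -> positive_operator A.
Proof.
move=> Ak k0 f f0;
  apply: filterS (kernel_real Ak (measurable_nnpart f) (nnpartE f0)).
move=> x [_ rE iE]; rewrite lecE rE iE /=; under eq_Rintegral do rewrite mul0r.
rewrite /Rintegral integral0 eqxx /=.
by apply: fine_ge0; apply: integral_ge0 => y _;
  rewrite lee_fin mulr_ge0// nnpart_ge0.
Qed.

End NonnegativePart.

(** * The inequality for the weighted geometric mean *)

Section MeanBound.
Context d (X : measurableType d) (R : realType) (mu : {measure set X -> \bar R}).
Context (L : banachFunctionSpace mu) (m : nat) (m_gt0 : (0 < m)%N).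
Context (A : 'I_m -> {linear L -> L}) (k : 'I_m -> X * X -> R[i]).
Hypotheses (A_ge0 : forall j, positive_operator (A j))
  (Ak : forall j, has_kernel (A j) (k j)).
Context (G : {linear L -> L}).
Hypothesis Gk : has_kernel G (hadamard_wgm_kernel (fun _ : 'I_m => m%:R^-1) k).
Local Notation repr := (@bfs_repr d X R mu L).

Let G_ge0 : positive_operator G.
Proof.
by apply: nonneg_kernel_positive Gk _ => z; apply: prodr_ge0 => j _;
  exact: powR_ge0.
Qed.

(** Take w = t g with g the geometric mean of the u_j. From t u_j >= f follows t g >= f, and Hoelder
    gives G g <= gmean_j (A_j u_(j+1)) <= gmean_j (t u_j) = t g. The norm bound holds because g is
    at most the sum of the u_j. *)
Lemma gmean_supersolution (t : R) (u : nat -> L) (f : L) :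
    0 < t -> bfs_ge0 f -> (forall j, bfs_ge0 (u j)) -> u 0%N = u m ->
    (forall j : 'I_m, t%:C *: u j = A j (u j.+1) + f) ->
  exists w, [/\ bfs_ge0 (w - f), bfs_ge0 (t%:C *: w - G w) &
    rnorm w <= t * rnorm (\sum_(j < m) u j)].
Proof.
move=> t0 f0 u0 u0m uE; pose p j := nnpart (u j).
have p0 j x : 0 <= p j x by exact: nnpart_ge0.
have mp j : measurable_fun setT (p j) by exact: measurable_nnpart.
have pE j : {ae mu, forall x, repr (u j) x = (p j x)%:C} by exact: nnpartE.
pose g x := gmean (fun j : 'I_m => p j x).
have mg : measurable_fun setT g by exact: measurable_gmean.
have [||h hg hu] := @bfs_ideal_real _ _ _ _ L (\sum_(j < m) u j) (fun x => (g
  x)%:C).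
- exact: cmeasurable_real.
- have S := bfs_repr_sum (index_enum 'I_m) (fun j => u j).
  have P : {ae mu, forall x, forall j : 'I_m, repr (u j) x = (p j x)%:C}.
    by apply: filter_forall => j; exact: pE.
  apply: filterS2 S P => x -> P; under eq_bigr do rewrite P.
  rewrite -rmorph_sum /= !ger0_norm ?lecR ?gmean_ge0 ?sumr_ge0//.
  rewrite (le_trans (gmean_le_sum _ _))// ler_piMl ?sumr_ge0//.
  by rewrite invf_le1 ?ltr0n// ler1n.
have ae_system : {ae mu, forall x, forall j : 'I_m, [/\
    t * p j x = complex.Re (repr (A j (u j.+1)) x) + nnpart f x,
    0 <= complex.Re (repr (A j (u j.+1)) x),
    mu.-integrable setT (EFin \o (fun y => complex.Re (k j (x, y)) * p j.+1 y)),
    complex.Re (repr (A j (u j.+1)) x) =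
      \int[mu]_y (complex.Re (k j (x, y)) * p j.+1 y) &
    {ae mu, forall y, 0 <= complex.Re (k j (x, y)) * p j.+1 y}]}.
  apply: filter_forall => j.
  have K1 := kernel_real (Ak j) (mp j.+1) (pE j.+1).
  have K2 := kernel_ge0 (Ak j) (A_ge0 j) (mp j.+1) (p0 j.+1) (pE j.+1).
  have D := bfs_reprD (A j (u j.+1)) f; rewrite -uE in D.
  have Z : {ae mu, forall x, repr (t%:C *: u j) x = (t * p j x)%:C /\
      repr f x = (nnpart f x)%:C}.
    apply: filterS3 (bfs_reprZ t%:C (u j)) (pE j) (nnpartE f0) => x -> -> ->.
    by rewrite rmorphM.
  have {}Z : {ae mu, forall x,
      t * p j x = complex.Re (repr (A j (u j.+1)) x) + nnpart f x /\
      0 <= complex.Re (repr (A j (u j.+1)) x)}.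
    apply: filterS3 D Z (A_ge0 j (u0 j.+1)) => x -> [e fE]; move: e.
    by rewrite fE; case: (repr (A j _) x) => a b [<- _]; rewrite lecE => /andP[].
  by apply: filterS3 Z K1 K2 => x [? ?] [? ? _] ?.
have th : {ae mu, forall x, repr (t%:C *: h) x = (t * g x)%:C}.
  by apply: filterS2 (bfs_reprZ t%:C h) hg => x -> ->; rewrite rmorphM.
exists (t%:C *: h); split.
- have D := bfs_reprB (t%:C *: h) f.
  have {}D : {ae mu, forall x, repr (t%:C *: h - f) x =
      (t * g x)%:C - repr (f) x} by apply: filterS2 D th => x -> ->.
  apply: filterS3 D (nnpartE f0) ae_system => x -> -> sys.
  rewrite -rmorphB lecR subr_ge0 -ler_pdivrMl//.
  rewrite -(@gmean_const _ _ m_gt0 (_ * _));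
    last by rewrite mulr_ge0 ?nnpart_ge0// invr_ge0 ltW.
  apply: gmean_le => // j; first by rewrite mulr_ge0 ?nnpart_ge0// invr_ge0 ltW.
  by rewrite ler_pdivrMl//; have [-> ? _ _ _] := sys j; rewrite lerDr.
- have -> : t%:C *: (t%:C *: h) - G (t%:C *: h) = t%:C *: (t%:C *: h - G h).
    by rewrite scalerBr [G _]linearZ.
  apply: (coneZ (bfs_normal_cone L)); first exact: ltW.
  have D := bfs_reprB (t%:C *: h) (G h).
  have {}D : {ae mu, forall x, repr (t%:C *: h - G h) x =
      (t * g x)%:C - repr (G h) x} by apply: filterS2 D th => x -> ->.
  apply: filterS3 D (kernel_real Gk mg hg) ae_system => x -> [_ Re_G Im_G] sys.
  have -> : repr (G h) x = (\int[mu]_y (gmean (fun j => complex.Re (k j (x, y))) *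
    g y))%:C.
    apply/eqP; rewrite eq_complex Re_G Im_G eqxx /=.
    by under eq_Rintegral do rewrite mul0r; rewrite /Rintegral integral0.
  rewrite -rmorphB lecR subr_ge0.
  (* The integrands are nonnegative only almost everywhere; truncation at 0 makes the integral
     inequality for geometric means applicable. *)
  pose q (j : 'I_m) y := Num.max 0 (complex.Re (k j (x, y)) * p j.+1 y).
  have mkp j : measurable_fun setT (fun y => complex.Re (k j (x, y)) * p j.+1 y).
    by apply/measurable_EFinP; have [_ _ /integrableP[]] := sys j.
  have q_ge0 j y : 0 <= q j y by rewrite le_max lexx.
  have mq j : measurable_fun setT (q j) by exact: measurable_maxr.
  have qE : {ae mu, forall y, forall j : 'I_m,
      q j y = complex.Re (k j (x, y)) * p j.+1 y /\ 0 <= complex.Re (k j (x, y)) *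
        p j.+1 y}.
    apply: filter_forall => j; have [_ _ _ _] := sys j.
    by apply: filterS => y ?; rewrite /q max_r.
  have iq j : mu.-integrable setT (EFin \o q j).
    have [_ _ ikp _ _] := sys j.
    have -> : q j = (fun y => complex.Re (k j (x, y)) * p j.+1 y)^\+.
      by apply/funext => y; rewrite /q maxC.
    exact: integrable_funrpos.
  have q_le j : \int[mu]_y q j y <= t * p j x.
    have [-> _ _ -> _] := sys j; rewrite -[leLHS]addr0 lerD ?nnpart_ge0//.
    rewrite le_eqVlt; apply/orP; left; apply/eqP; congr fine.
    apply: ae_eq_integral => //; try exact/measurable_EFinP.
    by apply: filterS qE => y /(_ j)[-> _].
  have -> : \int[mu]_y (gmean (fun j => complex.Re (k j (x, y))) * g y) =
      \int[mu]_y gmean (q ^~ y).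
    congr fine; apply: ae_eq_integral => //.
    + apply/measurable_EFinP; apply: measurable_funM => //.
      apply: measurable_gmean => j.
      by have [/(cmeasurable_section x)[]] := Ak j.
    + by apply/measurable_EFinP; exact: measurable_gmean.
    apply: filterS qE => y Q _; congr EFin.
    (* Since [u 0 = u m], the mean over [p j] equals the mean over [p j.+1], the factor paired with
       [k j]. *)
    rewrite /g (@gmean_shift _ _ (p ^~ y)); last by rewrite /p u0m.
    rewrite -gmeanM//; last by move=> j; exact: (Q j).2.
    by congr gmean; apply/funext => j; rewrite (Q j).1.
  have := integral_gmean_le m_gt0 q_ge0 iq; move/le_trans; apply.
  rewrite -{1}(@gmean_const _ _ m_gt0 t (ltW t0)) -gmeanM//.
    by apply: gmean_le => // j; apply: Rintegral_ge0 => y _.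
  by move=> j; rewrite mulr_ge0// ltW.
- by rewrite rnormZR gtr0_norm// ler_pM2l.
Qed.

Lemma spectral_radius_gmean_le :
  spectral_radius G <=
    spectral_radius (operator_product (fun j => A j : L -> L)) `^ m%:R^-1.
Proof.
set rho := spectral_radius (operator_product _).
have rho0 : 0 <= rho by exact: spectral_radius_ge0.
apply/ler_addgt0Pr => e e0; set t := _ + e.
have t0 : 0 < t by rewrite ltr_wpDl// powR_ge0.
have rho_t : rho < t ^+ m.
  rewrite -[ltLHS](powR_rootK m_gt0)// ltr_pXn2r ?nnegrE ?powR_ge0 ?(ltW t0)//.
  by rewrite ltrDl.
have coneL := bfs_normal_cone L.
have [T [T0 T0m TE]] := cyclic_system coneL A_ge0 t0 rho_t.
have TC j : exists C, 0 <= C /\ forall f, rnorm (T j f) <= C * rnorm f.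
  by have [C C0 TC] := positive_bounded coneL (T0 j); exists C.
have {TC} [C TC] := choice TC.
apply: (@spectral_radius_le_supersolution _ _ _ coneL _ _ (t * \sum_(j < m) C j)).
- exact: G_ge0.
- exact: ltW.
- by rewrite mulr_ge0 ?(ltW t0)// sumr_ge0// => j _; case: (TC j).
move=> f f0.
have [|||w [w1 w2 w3]] := @gmean_supersolution t (fun j => T j f) f t0 f0.
- by move=> j; exact: T0.
- by rewrite T0m.
- by move=> j; exact: TE.
exists w; split=> //; apply: (le_trans w3); rewrite -mulrA ler_pM2l// mulr_suml.
apply: (le_trans (rnorm_sum _ _)); apply: ler_sum => j _.
by case: (TC j).
Qed.

End MeanBound.

(** * Sequence spaces *)

Section SequenceIndex.
Context d (X : measurableType d) (R : realType) (mu : {measure set X -> \bar R}).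
Hypotheses (X_index : sequence_index X) (muE : forall A : set X, mu A = counting A).

Lemma sequence_index_inj : exists f : X -> nat, injective f.
Proof.
have [_ cX] := X_index.
suff /countable_injP [f finj] : countable [set: X].
  by exists f => x y; apply: finj; rewrite in_setT.
case: cX => [[n _ Xn]|Xn]; last by rewrite (eq_countable Xn); exact: countableP.
by rewrite (eq_countable Xn); exact: countableP.
Qed.

Lemma measurable_discrete d' (Y : measurableType d') (f : X -> Y) : measurable_fun
  setT f.
Proof. by move=> _ B mB; apply: X_index.1. Qed.

(** Points are rectangles and X * X is countable. This supplies the joint measurability for
    Tonelli's theorem. *)
Lemma measurable_discrete2 (A : set (X * X)) : measurable A.
Proof.
have [f finj] := sequence_index_inj.
apply: countable_measurable.
  move=> [x y]; rewrite (_ : [set (x, y)] = [set x] `*` [set y]).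
    by apply: measurableX; apply: X_index.1.
  by apply/seteqP; split=> [_ ->//|[a b] [/= -> ->]].
apply/countable_injP; exists (fun z => pickle (f z.1, f z.2)) => -[a b] [a' b'] _ _.
by move=> /(pcan_inj pickleK) [] /finj -> /finj ->.
Qed.

Lemma measure_singleton x : mu [set x] = 1%E.
Proof. by rewrite muE /counting asboolT// fset_set1 finmap.cardfs1. Qed.

(** Every point has mass 1, so null sets are empty. *)
Lemma ae_discrete (P : X -> Prop) : {ae mu, forall x, P x} -> forall x, P x.
Proof.
move=> [N [mN N0 PN]] x; apply: contrapT => nP.
have : (mu [set x] <= mu N)%E.
  apply: le_measure; rewrite ?inE//; first exact: X_index.1.
  by move=> _ ->; exact: PN.
by rewrite measure_singleton N0 lee_fin ler10.
Qed.

Lemma integral_singleton x (f : X -> \bar R) : (\int[mu]_(y in [set x]) f y = f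
  x)%E.
Proof.
have m1 : measurable [set x] by exact: X_index.1.
rewrite (eq_integral (fun=> f x)); last by move=> y; rewrite inE => ->.
by rewrite integral_cst// [X in (_ * X)%E]measure_singleton mule1.
Qed.

Lemma le_integral_discrete x (f : X -> \bar R) : (forall y, 0 <= f y)%E ->
  (f x <= \int[mu]_y f y)%E.
Proof.
move=> f0; rewrite -integral_singleton; apply: ge0_subset_integral => //.
- exact: X_index.1.
- exact: measurable_discrete.
Qed.

Lemma integral_indic_discrete x (f : X -> R) : \int[mu]_y (f y * \1_[set x] y) = f
  x.
Proof.
rewrite /Rintegral (_ : (fun y => _) = (fun y => (f y)%:E) \_ [set x]).
  by rewrite -integral_mkcond integral_singleton.
apply/funext => y; rewrite patchE indicE.
by case: (y \in _); rewrite ?mulr1 ?mulr0.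
Qed.

(* Dominating all factors but one by their integrals: a counting integral of
   nonnegative terms bounds each term. *)
Lemma integral_prod_le_discrete m (a : 'I_m -> X -> R) (b : 'I_m -> R) :
    (0 < m)%N -> (forall j x, 0 <= a j x) ->
    (forall j, \int[mu]_x (a j x)%:E <= (b j)%:E)%E ->
  (\int[mu]_x (\prod_(j < m) a j x)%:E <= (\prod_(j < m) b j)%:E)%E.
Proof.
move=> m0 a0 ab; pose i := Ordinal m0.
have ab' j x : a j x <= b j.
  rewrite -lee_fin (le_trans _ (ab j))//.
  by apply: (le_integral_discrete _ (f := fun x => (a j x)%:E)) => y;
    rewrite lee_fin.
have b0 j : 0 <= b j.
  by rewrite -lee_fin (le_trans _ (ab j))// integral_ge0// => y _; rewrite lee_fin.
apply: (@le_trans _ _ (\int[mu]_x ((\prod_(j < m | j != i) b j)%:E * (a i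
  x)%:E))%E).
  apply: ge0_le_integral => //.
  - by move=> x _; rewrite lee_fin prodr_ge0.
  - exact: measurable_discrete.
  - exact: measurable_discrete.
  move=> x _; rewrite -EFinM lee_fin (bigD1 i)//= mulrC ler_wpM2r//.
  by apply: ler_prod => j _; rewrite a0 ab'.
rewrite ge0_integralZl_EFin//; last 3 first.
- by move=> x _; rewrite lee_fin.
- exact: measurable_discrete.
- exact: prodr_ge0.
rewrite [X in (_ <= X%:E)%E](bigD1 i)//= [X in (_ <= X%:E)%E]mulrC EFinM.
by apply: lee_wpmul2l; rewrite ?lee_fin ?prodr_ge0.
Qed.

(** An injection into nat splits X into fibres of at most one point, and the partial sums of the
    resulting series are sums over finite lists. *)
Lemma integral_le_partial_sums (f : X -> R) (c : R) : (forall x, 0 <= f x) ->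
    (forall s : seq X, uniq s -> \sum_(x <- s) f x <= c) ->
  (\int[mu]_x (f x)%:E <= c%:E)%E.
Proof.
move=> f0 fc; have [h hinj] := sequence_index_inj.
pose F n := [set x | h x = n].
have mF n : measurable (F n) by exact: X_index.1.
have FT : \bigcup_n F n = setT by apply/seteqP; split=> // x _; exists (h x).
have tF : trivIset setT F by move=> i j _ _ [x [<- <-]].
rewrite -FT ge0_integral_bigcup//; last 2 first.
- by move=> _ B mB; exact: X_index.1.
- by move=> x _; rewrite lee_fin.
apply: lime_le; first by apply: is_cvg_nneseries => n _ _;
  apply: integral_ge0 => x _; rewrite lee_fin.
apply: nearW => n.
(* The list [s] holds the points of index below n; the bound on indices shows that the next point is
   new. *)
suff [s us [sn ->]] : exists2 s : seq X, uniq s & (forall x, x \in s -> (h x <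
  n)%N) /\
    (\sum_(0 <= i < n) \int[mu]_(x in F i) (f x)%:E = (\sum_(x <- s) f x)%:E)%E.
  by rewrite lee_fin fc.
elim: n => [|n [s us [sn IH]]]; first by exists [::] => //;
  rewrite big_geq// big_nil.
have [[x hx]|nx] := pselect (exists x, h x = n).
  exists (x :: s); first by rewrite /= us andbT; apply/negP => /sn; rewrite hx ltnn.
  split=> [y|].
    by rewrite inE => /orP[/eqP ->|/sn/ltnW]; rewrite ?hx// ltnS.
  rewrite big_nat_recr//= IH big_cons EFinD addeC; congr (_ + _)%E.
  rewrite (_ : F n = [set x]) ?integral_singleton//.
  by apply/seteqP; split=> [y hy|_ ->//]; apply: hinj; rewrite hx.
exists s => //; split=> [y /sn/ltnW //|].
rewrite big_nat_recr//= IH (_ : F n = set0) ?integral_set0 ?adde0//.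
by apply/seteqP; split=> // x hx; apply: nx; exists x.
Qed.

End SequenceIndex.

(** * The inequality for the Hadamard product *)

Section SequenceSpace.
Context d (X : measurableType d) (R : realType)
  (mu : {sigma_finite_measure set X -> \bar R}).
Context (L : banachFunctionSpace mu) (m : nat) (m_gt0 : (0 < m)%N).
Context (A : 'I_m -> {linear L -> L}) (k : 'I_m -> X * X -> R[i]).
Hypotheses (A_ge0 : forall j, positive_operator (A j))
  (Ak : forall j, has_kernel (A j) (k j)).
Hypotheses (X_index : sequence_index X) (muE : forall B : set X, mu B = counting B).
Context (e : X -> L).
Local Notation repr := (@bfs_repr d X R mu L).
Hypotheses (eE : forall i j, repr (e i) j = (j == i)%:R) (e_norm : forall i, `|e i|
  = 1).
Context (H : {linear L -> L}).
Hypothesis Hk : has_kernel H (fun z => \prod_(j < m) k j z).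

Let everywhere (P : X -> Prop) : {ae mu, forall x, P x} -> forall x, P x.
Proof. exact: ae_discrete X_index muE P. Qed.

Let mfun (f : X -> R) : measurable_fun setT f.
Proof. exact: (measurable_discrete X_index). Qed.

Let e_ge0 y : bfs_ge0 (e y).
Proof. by apply: aeW => x; rewrite eE ler0n. Qed.

Let e_indic y : {ae mu, forall x, repr (e y) x = (\1_[set y] x)%:C}.
Proof.
apply: aeW => x; rewrite eE indicE (_ : (x \in [set y]) = (x == y));
  first by case: eqP.
by apply/idP/eqP => [|->]; rewrite inE.
Qed.

Let repr_ge0 (f : L) x : bfs_ge0 f -> repr f x = (complex.Re (repr f x))%:C /\
  0 <= complex.Re (repr f x).
Proof.
move=> /everywhere/(_ x) fx; have E := ge0_complexE fx; split=> //.
by rewrite -lecR -E.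
Qed.

Let kr (j : 'I_m) x y := complex.Re (k j (x, y)).

(** The entry k_j(x, y) is the value at x of A_j e_y, an element of the cone. *)
Let kE (j : 'I_m) x y : k j (x, y) = (kr j x y)%:C /\ 0 <= kr j x y.
Proof.
have [_] := everywhere (kernel_real (Ak j) (mfun _) (e_indic y)) x.
rewrite !(integral_indic_discrete X_index muE) => rE iE.
have [E0 r0] := repr_ge0 x (A_ge0 j (e_ge0 y)).
have I0 : complex.Im (repr (A j (e y)) x) = 0 by rewrite E0.
split; last by rewrite /kr -rE.
by apply/eqP; rewrite eq_complex /= -iE I0 !eqxx.
Qed.

Let H_ge0 : positive_operator H.
Proof.
apply: (@nonneg_kernel_positive _ _ _ _ L H (fun z => \prod_(j < m) kr j z.1 z.2)).
  rewrite (_ : (fun z => _) = fun z => \prod_(j < m) k j z)//.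
  apply/funext => -[x y] /=; rewrite rmorph_prod.
  by apply: eq_bigr => j _; rewrite (kE j x y).1.
by move=> z; apply: prodr_ge0 => j _; exact: (kE j _ _).2.
Qed.

Let rnorm_e y : rnorm (e y) = 1.
Proof. by rewrite /rnorm e_norm. Qed.

(** The vector f(x) e_x is dominated by f, and e_x has norm 1. *)
Lemma coordinate_le_norm (f : L) x : complex.Re (repr f x) <= rnorm f.
Proof.
have : rnorm (repr f x *: e x) <= rnorm f.
  apply: bfs_norm_le; apply: filterS (bfs_reprZ (repr f x) (e x)) => z ->.
  rewrite eE; have [->|_] := eqVneq z x; first by rewrite mulr1.
  by rewrite mulr0 normr0.
rewrite rnormZ rnorm_e mulr1; apply: le_trans.
case: (repr f x) => a b /=; apply: le_trans (ler_norm _) _.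
by rewrite -sqrtr_sqr ler_wsqrtr// lerDl sqr_ge0.
Qed.

(** With w_j(., y) = T_j e_y, the source e_y gives t w_j(y, y) >= 1, so t^m W(y, y) >= 1 and t^m
    sum_y f(y) W(., y) dominates f. Bounding all factors of W except w_0 by the C_j keeps the sum
    below a multiple of T_0 f, hence in L. *)
Lemma product_supersolution (t : R) (T : nat -> {linear L -> L}) (C : nat -> R) (f
  : L) :
    0 < t -> (forall j, 0 <= C j) -> (forall j, positive (@bfs_ge0 d X R mu L) (T
      j)) ->
    (forall j v, rnorm (T j v) <= C j * rnorm v) -> (T 0%N : L -> L) = T m ->
    (forall (j : 'I_m) v, t%:C *: T j v = A j (T j.+1 v) + v) -> bfs_ge0 f ->
  exists w, [/\ bfs_ge0 (w - f), bfs_ge0 ((t ^+ m)%:C *: w - H w) &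
    rnorm w <= t ^+ m * \prod_(j < m) C j * rnorm f].
Proof.
move=> t0 C0 T0 TC T0m TE f0.
pose w (j : nat) x y := complex.Re (repr (T j (e y)) x).
have wE j x y : repr (T j (e y)) x = (w j x y)%:C /\ 0 <= w j x y.
  exact: repr_ge0 (T0 j _ (e_ge0 y)).
have w0 j x y : 0 <= w j x y by exact: (wE j x y).2.
have wC j x y : w j x y <= C j.
  apply: (le_trans (coordinate_le_norm _ _)); apply: (le_trans (TC j _)).
  by rewrite rnorm_e mulr1.
pose a (j : 'I_m) x y z := kr j x z * w j.+1 z y.
have a0 j x y z : 0 <= a j x y z by rewrite mulr_ge0//; exact: (kE j x z).2.
have aE (j : 'I_m) x y : (\int[mu]_z (a j x y z)%:E <= (t * w j x y)%:E)%E.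
  have wae : {ae mu, forall z, repr (T j.+1 (e y)) z = (w j.+1 z y)%:C}.
    by apply: aeW => z; exact: (wE j.+1 z y).1.
  have [ia Aa _] := everywhere (kernel_real (Ak j) (mfun _) wae) x.
  have -> : (\int[mu]_z (a j x y z)%:E = (\int[mu]_z a j x y z)%:E)%E.
    by rewrite /Rintegral fineK//; apply: integrable_fin_num.
  rewrite lee_fin /a -Aa.
  have Z := everywhere (bfs_reprZ t%:C (T j (e y))) x.
  have := everywhere (bfs_reprD (A j (T j.+1 (e y))) (e y)) x.
  rewrite -TE Z (wE j x y).1 eE.
  have [-> _] := repr_ge0 x (A_ge0 j (T0 j.+1 _ (e_ge0 y))).
  rewrite -(rmorph_nat (real_complex R)) -rmorphM -rmorphD => /complexI -> /=.
  by rewrite lerDl ler0n.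
have tw (j : 'I_m) y : 1 <= t * w j y y.
  have Z := everywhere (bfs_reprZ t%:C (T j (e y))) y.
  have := everywhere (bfs_reprD (A j (T j.+1 (e y))) (e y)) y.
  rewrite -TE Z (wE j y y).1 eE eqxx.
  have [-> ?] := repr_ge0 y (A_ge0 j (T0 j.+1 _ (e_ge0 y))).
  by rewrite -(rmorph_nat (real_complex R)) -rmorphM -rmorphD => /complexI ->;
    rewrite lerDr.
pose W x y := \prod_(j < m) w j x y.
have W0 x y : 0 <= W x y by apply: prodr_ge0.
have shiftW x y : W x y = \prod_(j < m) w j.+1 x y.
  by apply: (prod_shift (F := fun j => w j x y)); rewrite /w T0m.
have HW x y : (\int[mu]_z ((\prod_(j < m) kr j x z) * W z y)%:E <=
    (t ^+ m * W x y)%:E)%E.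
  have -> : t ^+ m * W x y = \prod_(j < m) (t * w j x y).
    by rewrite big_split prodr_const card_ord.
  rewrite (eq_integral (fun z => (\prod_(j < m) a j x y z)%:E)).
    exact: (integral_prod_le_discrete X_index muE).
  by move=> z _; rewrite shiftW -big_split.
pose i := Ordinal m_gt0; pose B := \prod_(j < m | j != i) C j.
have B0 : 0 <= B by apply: prodr_ge0.
pose p := nnpart f.
have p0 y : 0 <= p y by exact: nnpart_ge0.
have pE y : repr f y = (p y)%:C by exact: everywhere (nnpartE f0) y.
have sum_le x (s : seq X) : uniq s ->
    \sum_(y <- s) w 0%N x y * p y <= complex.Re (repr (T 0%N f) x).
  (* The finite truncation [fs] lies below f, so positivity of [T 0] bounds the partial sums by T_0
     f without any exchange of [T 0] with an infinite sum. *)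
  move=> us; pose fs := \sum_(y <- s) (p y)%:C *: e y.
  have fsE : bfs_ge0 (f - fs).
    apply: filterS2 (bfs_reprB f fs) (bfs_repr_sum s (fun y => (p y)%:C *: e y)).
    move=> z -> ->; rewrite pE.
    have -> : \sum_(y <- s) repr ((p y)%:C *: e y) z = (\sum_(y <- s) p y * (z ==
      y)%:R)%:C.
      rewrite rmorph_sum; apply: eq_bigr => y _.
      by rewrite (everywhere (bfs_reprZ _ _)) eE rmorphM rmorph_nat.
    rewrite -rmorphB lecR subr_ge0.
    have [zs|zs] := boolP (z \in s).
      rewrite (bigD1_seq z)//= eqxx mulr1 big1 ?addr0// => y /negPf yz.
      by rewrite eq_sym yz mulr0.
    rewrite big_seq big1// => y ys; case: eqP => [zy|_]; last by rewrite mulr0.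
    by rewrite zy ys in zs.
  have := everywhere (T0 0%N _ fsE) x; rewrite linearB linear_sum.
  rewrite (everywhere (bfs_reprB _ _)) (everywhere (bfs_repr_sum _ _)).
  have -> : \sum_(y <- s) repr (T 0%N ((p y)%:C *: e y)) x = (\sum_(y <- s) w 0%N x
    y * p y)%:C.
    rewrite rmorph_sum; apply: eq_bigr => y _.
    by rewrite linearZ (everywhere (bfs_reprZ _ _)) (wE 0%N x y).1 -rmorphM mulrC.
  by rewrite (repr_ge0 x (T0 0%N _ f0)).1 -rmorphB lecR subr_ge0.
pose q x := complex.Re (repr (T 0%N f) x).
have qE x : repr (T 0%N f) x = (q x)%:C /\ 0 <= q x by exact: repr_ge0 (T0 0%N _
  f0).
have W_le x y : W x y <= B * w 0%N x y.
  rewrite /W (bigD1 i)//= mulrC ler_wpM2r//; apply: ler_prod => j _.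
  by rewrite w0 wC.
have Wp_le x : (\int[mu]_y (W x y * p y)%:E <= (B * q x)%:E)%E.
  apply: (integral_le_partial_sums X_index muE) => [y|s us]; first exact: mulr_ge0.
  apply: le_trans (ler_wpM2l B0 (sum_le x s us)).
  by rewrite mulr_sumr; apply: ler_sum => y _; rewrite mulrA ler_wpM2r.
pose g x := \int[mu]_y (W x y * p y).
have gE x : (\int[mu]_y (W x y * p y)%:E = (g x)%:E)%E.
  rewrite /g /Rintegral fineK// ge0_fin_numE;
    first exact: le_lt_trans (Wp_le x) (ltry _).
  by apply: integral_ge0 => y _; rewrite lee_fin mulr_ge0.
have g0 x : 0 <= g x by apply: Rintegral_ge0 => y _; exact: mulr_ge0.
have g_le x : g x <= B * q x by rewrite -lee_fin -gE.
have [||h /everywhere hE hq] := @bfs_ideal_real _ _ _ _ L (B%:C *: T 0%N f) (fun x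
  => (g x)%:C).
- by apply: cmeasurable_real; exact: mfun.
- apply: filterS (bfs_reprZ B%:C (T 0%N f)) => x ->.
  by rewrite (qE x).1 -rmorphM !ger0_norm ?lecR ?mulr_ge0 ?(qE x).2.
have Hg x : (\int[mu]_z ((\prod_(j < m) kr j x z) * g z)%:E <= (t ^+ m * g x)%:E)%E.
  (* Tonelli's theorem exchanges the action of H with the superposition over y, which reduces the
     claim to the columns W(., y). *)
  pose F (zy : X * X) := ((\prod_(j < m) kr j x zy.1) * (W zy.1 zy.2 * p zy.2))%:E.
  have kr0 z : 0 <= \prod_(j < m) kr j x z by apply: prodr_ge0 => j _;
    exact: (kE j x z).2.
  have F0 zy : (0 <= F zy)%E by rewrite lee_fin !mulr_ge0.
  have mF : measurable_fun setT F.
    by move=> _ Y mY; exact: (measurable_discrete2 X_index).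
  rewrite (eq_integral (fun z => \int[mu]_y F (z, y))%E); last first.
    move=> z _; rewrite /F /=; under eq_integral do rewrite EFinM.
    rewrite ge0_integralZl_EFin// ?gE -?EFinM//.
    - by move=> y _; rewrite lee_fin mulr_ge0.
    - exact: (measurable_discrete X_index).
  rewrite (fubini_tonelli F)//.
  apply: (@le_trans _ _ (\int[mu]_y ((t ^+ m)%:E * (W x y * p y)%:E))%E);
    last first.
    rewrite ge0_integralZl_EFin ?gE -?EFinM//.
    - by move=> y _; rewrite lee_fin mulr_ge0.
    - exact: (measurable_discrete X_index).
    - by rewrite exprn_ge0// ltW.
  apply: ge0_le_integral => //.
  - by move=> y _; exact: integral_ge0.
  - exact: (measurable_discrete X_index).
  - exact: (measurable_discrete X_index).
  move=> y _; rewrite /F /=.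
  under eq_integral do rewrite mulrA mulrC EFinM.
  rewrite ge0_integralZl_EFin//; last 2 first.
  - by move=> z _; rewrite lee_fin mulr_ge0.
  - exact: (measurable_discrete X_index).
  apply: (le_trans (lee_wpmul2l _ (HW x y))); first by rewrite lee_fin.
  by rewrite -!EFinM (_ : p y * _ = t ^+ m * (W x y * p y))//; ring.
have th x : repr ((t ^+ m)%:C *: h) x = (t ^+ m * g x)%:C.
  by rewrite (everywhere (bfs_reprZ _ _)) hE -rmorphM.
exists ((t ^+ m)%:C *: h); split.
- apply: filterS (bfs_reprB ((t ^+ m)%:C *: h) f) => x ->.
  rewrite th pE -rmorphB lecR subr_ge0.
  have : ((W x x * p x)%:E <= (g x)%:E)%E.
    rewrite -gE;
      apply: (@le_integral_discrete _ _ _ mu X_index muE x (fun y => (W x y * p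
      y)%:E)).
    by move=> y; rewrite lee_fin mulr_ge0.
  rewrite lee_fin => Wg; have tm0 : 0 <= t ^+ m by rewrite exprn_ge0// ltW.
  apply: le_trans (ler_wpM2l tm0 Wg); rewrite mulrA ler_peMl//.
  have -> : t ^+ m * W x x = \prod_(j < m) (t * w j x x).
    by rewrite big_split prodr_const card_ord.
  (* Each factor is at least 1 by [tw]. *)
  by elim/big_ind: _ => // u v; exact: mulr_ege1.
- have -> : (t ^+ m)%:C *: ((t ^+ m)%:C *: h) - H ((t ^+ m)%:C *: h) =
      (t ^+ m)%:C *: ((t ^+ m)%:C *: h - H h) by rewrite scalerBr [H _]linearZ.
  apply: (coneZ (bfs_normal_cone L)); first by rewrite exprn_ge0// ltW.
  have hae : {ae mu, forall x, repr h x = (g x)%:C} by exact: aeW.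
  apply: filterS2 (bfs_reprB ((t ^+ m)%:C *: h) (H h)) (kernel_real Hk (mfun g)
    hae).
  move=> x -> [ih Re_H _]; rewrite th.
  have h0 : bfs_ge0 h by apply: aeW => z; rewrite hE lecR.
  have krE z : complex.Re (\prod_(j < m) k j (x, z)) = \prod_(j < m) kr j x z.
    rewrite (eq_bigr (fun j => (kr j x z)%:C)); last by move=> j _;
      rewrite (kE j x z).1.
    by rewrite -rmorph_prod.
  rewrite (repr_ge0 x (H_ge0 h0)).1 -rmorphB lecR subr_ge0 Re_H -lee_fin.
  rewrite /Rintegral fineK; last exact: integrable_fin_num.
  by under eq_integral do rewrite krE.
- rewrite rnormZR ger0_norm; last by rewrite exprn_ge0// ltW.
  rewrite -mulrA ler_wpM2l ?exprn_ge0 ?(ltW t0)//.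
  apply: (le_trans hq); rewrite rnormZR ger0_norm// (bigD1 i)//= -/B.
  by apply: (le_trans (ler_wpM2l B0 (TC 0%N f))); rewrite mulrA [B * _]mulrC.
Qed.

Lemma spectral_radius_hadamard_le :
  spectral_radius H <= spectral_radius (operator_product (fun j => A j : L -> L)).
Proof.
set rho := spectral_radius (operator_product _).
have rho0 : 0 <= rho by exact: spectral_radius_ge0.
apply/ler_addgt0Pr => eps eps0; pose t := (rho + eps) `^ m%:R^-1.
have re0 : 0 < rho + eps by rewrite ltr_wpDl.
have t0 : 0 < t by exact: powR_gt0.
have tm : t ^+ m = rho + eps by rewrite powR_rootK// ltW.
have coneL := bfs_normal_cone L.
have [|T [T0 T0m TE]] := cyclic_system coneL A_ge0 t0; first by rewrite tm ltrDl.
have TC j : exists C, 0 <= C /\ forall f, rnorm (T j f) <= C * rnorm f.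
  by have [C C0 TC] := positive_bounded coneL (T0 j); exists C.
have {TC} [C TC] := choice TC.
have C0 j : 0 <= C j by case: (TC j).
rewrite -tm.
apply: (@spectral_radius_le_supersolution _ _ _ coneL _ _ (t ^+ m * \prod_(j < m) C
  j)).
- exact: H_ge0.
- by rewrite exprn_ge0// ltW.
- by rewrite mulr_ge0 ?exprn_ge0 ?(ltW t0)// prodr_ge0.
move=> f f0; apply: (product_supersolution t0 C0 T0 _ T0m TE f0) => j.
by case: (TC j).
Qed.

End SequenceSpace.

Theorem theorem3p1 (R : realType) (d : measure_display) (X : measurableType d)
    (mu : {sigma_finite_measure set X -> \bar R})
    (L : banachFunctionSpace mu) (m : nat) (m_gt0 : (0 < m)%N)
    (A : 'I_m -> {linear L -> L}) (k : 'I_m -> X * X -> R[i])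
    (A_positive : forall j, positive_operator (A j))
    (A_kernel : forall j, has_kernel (A j) (k j)) :
  (forall G : {linear L -> L},
     has_kernel G (hadamard_wgm_kernel (fun _ : 'I_m => m%:R^-1) k) ->
     spectral_radius G
       <= spectral_radius (operator_product (fun j => A j : L -> L)) `^ m%:R^-1)
  /\
  (normalized_sequence_space L ->
   forall H : {linear L -> L},
     has_kernel H (fun z => \prod_(j < m) k j z) ->
     spectral_radius H
       <= spectral_radius (operator_product (fun j => A j : L -> L))).
Proof.
split=> [G Gk|[X_index muE ex_e] H Hk]; first exact: spectral_radius_gmean_le Gk.
have /choice [e eP] : forall i, exists e : L,
    (forall j, bfs_repr e j = (j == i)%:R) /\ `|e| = 1.
  by move=> i; have [e] := ex_e i; exists e.
by apply: (@spectral_radius_hadamard_le _ _ _ _ _ _ m_gt0 _ k A_positive A_kernel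
  X_index muE e _ _ _ Hk) => i; case: (eP i).
Qed.
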